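(* Suppose that $V_h$ is the space of continuous piecewise polynomials of degree $r>1$ and that $\alpha\neq 0$ (and set $p=2$ in the definitions of $B_h$ and of the energy norm). Then for all sufficiently small $\theta>0$ there exists a constant $C>0$, independent of $h$, such that for all $v\in V_h$ $$B_h(v,v)\ \ge\ C\,|||v|||^2 .$$
   Context: Let $\Omega_s\subset\mathbb{R}^d$ be a bounded spatial domain, $T>0$, and $\Omega=\Omega_s\times(0,T)$ the space-time domain. Let $\alpha\ge 0$, $\gamma\ge 0$ and $\boldsymbol\beta\in\mathbb{R}^d$ be constants, and set $$Lu=u_t-\alpha\Delta u+\boldsymbol\beta\cdot\nabla u+\gamma u ,$$ where $\nabla,\Delta$ act in the space variables only. $\mathcal H^1_E(\Omega)$ is the subspace of $H^1(\Omega)$ of functions vanishing on $\partial\Omega_s\times(0,T)$ and on $\Omega_s\times\{t=0\}$. Write $(u,v)=\int_{\Omega_s}uv\,dx$ and $\|\cdot\|$ for the $L^2(\Omega_s)$ inner product and norm, and $$B(u,v)=\int_0^T (u_t,v)+\alpha(\nabla u,\nabla v)+(\boldsymbol\beta\cdot\nabla u,v)+\gamma(u,v)\,dt .$$ $\Omega$ is covered by a shape regular quasiuniform tessellation $\mathcal T_h$ of elements of size $h$, and $V_h\subset\mathcal H^1_E(\Omega)$ is a $C^0$ conforming piecewise polynomial finite element space on $\mathcal T_h$. Let $\nu=(|\boldsymbol\beta|^2+1)^{-1/2}$. With exponent $p$ and parameter $\theta$, $$B_h(u,v)=B(u,v)+\int_0^T\big(Lu,\ \theta h^p\nu(\boldsymbol\beta\cdot\nabla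 v+v_t)\big)\,dt ,$$ where the last term is interpreted elementwise on $\mathcal T_h$. The energy norm is $$|||u|||^2=\|u(T)\|^2+\int_0^T \alpha\|\nabla u\|^2+h^p\nu\|\boldsymbol\beta\cdot\nabla u+u_t\|^2+\gamma\|u\|^2\,dt .$$ *)

(* Defs.v *)
From HB Require Import structures.
From mathcomp Require Import all_boot all_order all_algebra.
(* Notations of mpoly clash with those of MathComp-Analysis; the analysis
   library comes last so that its names win. *)
From mathcomp Require Import -(notations) mpoly.
From mathcomp Require Import all_classical all_reals all_analysis.

Set Implicit Arguments.
Unset Strict Implicit.
Unset Printing Implicit Defensive.

Import Order.TTheory GRing.Theory Num.Theory.
Import numFieldNormedType.Exports.

Local Open Scope classical_set_scope.
Local Open Scope ring_scope.

(* Lebesgue measure on R^n, restricted to its Borel sets (the product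
   sigma-algebra of n.-tuple), as the n-fold product of lebesgue_measure. *)
Section lebesgue_step.
Context (R : realType) (n : nat).
Local Notation T := (measurableTypeR R).

Definition cons_pair (p : T * n.-tuple T) : n.+1.-tuple T :=
  [the n.+1.-tuple T of p.1 :: p.2].

Lemma measurable_cons_pair : measurable_fun setT cons_pair.
Proof.
by apply: measurable_cons; [exact: measurable_fst|exact: measurable_snd].
Qed.

Variable m : {sigma_finite_measure set (n.-tuple T) -> \bar R}.

Definition leb_step : set (n.+1.-tuple T) -> \bar R :=
  pushforward (product_measure1 (@lebesgue_measure R) m) cons_pair.

Let preim A : measurable A -> measurable (cons_pair @^-1` A).
Proof. by move=> mA; rewrite -[X in measurable X]setTI; exact: measurable_cons_pair. Qed.

Let leb_step0 : leb_step set0 = 0%E.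
Proof. by rewrite /leb_step /pushforward preimage_set0 measure0. Qed.

Let leb_step_ge0 A : (0 <= leb_step A)%E.
Proof. by rewrite /leb_step /pushforward measure_ge0. Qed.

Let leb_step_sigma_additive : semi_sigma_additive leb_step.
Proof.
move=> F mF tF mUF; rewrite /leb_step /pushforward preimage_bigcup.
apply: measure_semi_sigma_additive.
- by move=> k; exact: preim.
- apply/trivIsetP => /= i j _ _ ij; rewrite -preimage_setI.
  by move/trivIsetP : tF => /(_ _ _ _ _ ij) ->//; rewrite preimage_set0.
- by rewrite -preimage_bigcup; exact: preim.
Qed.

HB.instance Definition _ := isMeasure.Build _ _ _
  leb_step leb_step0 leb_step_ge0 leb_step_sigma_additive.

Let uncons (s : n.+1.-tuple T) : T * n.-tuple T :=
  (thead s, [tuple of behead s]).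

Let measurable_uncons : measurable_fun setT uncons.
Proof.
apply/measurable_fun_pairP; split.
  exact: measurable_tnth.
exact: measurable_behead.
Qed.

Let cons_pairK : cancel cons_pair uncons.
Proof.
by case=> x s; rewrite /uncons /=; congr pair; apply/val_inj.
Qed.

Let leb_step_sigma_finite : sigma_finite setT leb_step.
Proof.
have /sigma_finiteP[F [TF ndF Foo]] := sigma_finiteT (@lebesgue_measure R).
have /sigma_finiteP[G [TG ndG Goo]] := sigma_finiteT m.
exists (fun k => uncons @^-1` (F k `*` G k)).
  rewrite -preimage_bigcup -(preimage_setT uncons); congr (_ @^-1` _).
  rewrite -setXTT TF TG predeqE => -[x y]; split.
    move=> [/= [k _ Fkx] [l _ Gly]]; exists (maxn k l) => //; split.
      by move: x Fkx; exact/subsetPset/ndF/leq_maxl.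
    by move: y Gly; exact/subsetPset/ndG/leq_maxr.
  by move=> [k _ []/= ? ?]; split; exists k.
move=> k; have [mF Fk] := Foo k; have [mG Gk] := Goo k; split.
  rewrite -[X in measurable X]setTI; apply: measurable_uncons => //.
  exact: measurableX.
rewrite /leb_step /pushforward -comp_preimage.
rewrite (_ : uncons \o cons_pair = id); last first.
  by apply/funext => x /=; rewrite cons_pairK.
by rewrite preimage_id product_measure1E// lte_mul_pinfty// ge0_fin_numE.
Qed.

HB.instance Definition _ := Measure_isSigmaFinite.Build _ _ _
  leb_step leb_step_sigma_finite.

End lebesgue_step.

Fixpoint leb (R : realType) (n : nat)
    : {sigma_finite_measure set (n.-tuple (measurableTypeR R)) -> \bar R} :=
  match n with
  | 0 => \d_([tuple] : 0.-tuple (measurableTypeR R))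
  | n.+1 => leb_step (leb R n)
  end.

Section spacetime.
Context (R : realType) (d : nat).

Local Notation space := 'rV[R]_d.
Local Notation spacetime := ('rV[R]_d * R)%type.
Implicit Types (Os : set space) (K : set spacetime) (z : spacetime).
Implicit Types (alpha gamma theta h T : R) (beta : space).

Definition vec (s : d.-tuple (measurableTypeR R)) : space := \row_i tnth s i.

Definition ip Os (f g : space -> R) : R :=
  \int[leb R d]_(s in vec @^-1` Os) (f (vec s) * g (vec s)).

Definition at_time (u : spacetime -> R) (t : R) : space -> R :=
  fun x => u (x, t).

Definition time_int T (F : R -> R) : R :=
  \int[@lebesgue_measure R]_(t in `]0, T[) F t.

(* The norms of the library on 'rV[R]_d and on pairs are sup norms; this
   is the Euclidean one. *)
Definition enorm z : R := Num.sqrt (\sum_(i < d) z.1 0 i ^+ 2 + z.2 ^+ 2).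

Definition spatial_domain Os : Prop :=
  [/\ open Os, connected Os, Os !=set0 & bounded_set Os].

Definition cylinder Os T : set spacetime := Os `*` `]0, T[.

Definition polytope K : Prop :=
  exists (m : nat) (p : 'I_m.+1 -> spacetime),
    K = [set z | exists w : 'I_m.+1 -> R,
          [/\ forall j, 0 <= w j, \sum_j w j = 1 & z = \sum_j w j *: p j]].

Definition diam K : R :=
  sup [set l | exists z1 z2, [/\ K z1, K z2 & l = enorm (z1 - z2)]].

(* Elements are closed convex polytopes.  Neither simplices nor face-to-face
   matching are required. *)
Definition tessellation Os T (N : nat) (Th : 'I_N -> set spacetime) : Prop :=
  [/\ forall j, polytope (Th j) /\ (Th j)° !=set0,
      forall i j, i != j -> (Th i)° `&` (Th j)° = set0,
      forall j, (Th j)° `<=` cylinder Os T &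
      closure (cylinder Os T) = \bigcup_j Th j].

Definition shape_regular (sigma : R) (N : nat) (Th : 'I_N -> set spacetime)
    : Prop :=
  forall j, exists c, forall z, enorm (z - c) <= sigma * diam (Th j) -> Th j z.

Definition quasiuniform (kappa h : R) (N : nat) (Th : 'I_N -> set spacetime)
    : Prop :=
  forall j, kappa * h <= diam (Th j) <= h.

Definition poly_eval (p : mpoly d.+1 R) z : R :=
  meval (fun i => if unlift ord_max i is Some j then z.1 0 j else z.2) p.

Definition poly_on (r : nat) K (v : spacetime -> R) : Prop :=
  exists2 p : mpoly d.+1 R,
    (msize p <= r.+1)%N & forall z, K z -> v z = poly_eval p z.

(* Only the values of v on the closure of the cylinder matter.  A continuous
   piecewise polynomial function is in H^1, its weak derivatives are the
   elementwise ones, and its traces are its pointwise restrictions; so this is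
   the subspace of H^1_E of continuous piecewise polynomials of degree r. *)
Definition Vh (r : nat) Os T (N : nat) (Th : 'I_N -> set spacetime)
    (v : spacetime -> R) : Prop :=
  [/\ {within closure (cylinder Os T), continuous v},
      forall j, poly_on r (Th j) v,
      forall x t, (closure Os `\` Os) x -> 0 < t < T -> v (x, t) = 0 &
      forall x, Os x -> v (x, 0) = 0].

Section forms.
Context (alpha gamma : R) (beta : space).
Context (Os : set space) (T : R) (N : nat) (Th : 'I_N -> set spacetime).
Implicit Types u v : spacetime -> R.

(* Elementwise directional derivative; it is set to 0 on the mesh skeleton,
   a null set where it need not exist. *)
Definition hderive (a : spacetime) u : spacetime -> R :=
  fun z => if z \in \bigcup_j (Th j)° then 'D_a u z else 0.

Definition hdx (i : 'I_d) := hderive (delta_mx 0 i, 0).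
Definition hdt := hderive (0, 1).

Definition hlaplace u z : R := \sum_(i < d) hdx i (hdx i u) z.
Definition hadv u z : R := \sum_(i < d) beta 0 i * hdx i u z.
Definition hstream u z : R := hadv u z + hdt u z.
Definition hL u z : R :=
  hdt u z - alpha * hlaplace u z + hadv u z + gamma * u z.

Definition nu : R := (Num.sqrt (\sum_(i < d) beta 0 i ^+ 2 + 1))^-1.

Definition B u v : R :=
  time_int T (fun t =>
    ip Os (at_time (hdt u) t) (at_time v t)
    + alpha * (\sum_(i < d) ip Os (at_time (hdx i u) t) (at_time (hdx i v) t))
    + ip Os (at_time (hadv u) t) (at_time v t)
    + gamma * ip Os (at_time u t) (at_time v t)).

Definition Bh (p : nat) (h theta : R) u v : R :=
  B u v + time_int T (fun t =>
    ip Os (at_time (hL u) t)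
          (at_time (fun z => theta * h ^+ p * nu * hstream v z) t)).

Definition energy_norm (p : nat) (h : R) u : R :=
  Num.sqrt (ip Os (at_time u T) (at_time u T)
    + time_int T (fun t =>
        alpha * (\sum_(i < d) ip Os (at_time (hdx i u) t) (at_time (hdx i u) t))
        + h ^+ p * nu * ip Os (at_time (hstream u) t) (at_time (hstream u) t)
        + gamma * ip Os (at_time u t) (at_time u t))).

End forms.
End spacetime.

(* Main.v *)
(* Write s(v) = v_t + beta.grad v.  Along the characteristics t |-> x + t beta
   the function v^2, extended by 0 outside the domain, is continuous and piecewise
   polynomial, and starts from 0.  Integrating its derivative
   2 v s(v) over all characteristics (the shear (x, t) |-> x + t beta preserves
   the measure) gives int_0^T (s(v), v) dt = |v(T)|^2 / 2.  This yields
   B(v, v), and also shows that the stabilization term gamma (v, s(v)) is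
   nonnegative.  The only term without a sign is -alpha (Delta v, s(v)), which
   Young's inequality splits into |s(v)|^2 / 2, absorbed by the
   stabilization, and alpha^2 |Delta v|^2 / 2, which the inverse inequality
   h |Delta v| <= K |grad v| on each element lets alpha |grad v|^2 absorb when
   theta is small.

   For the inverse inequality, each element contains a cube of side comparable
   to h and lies in a cube of comparable side.  A polynomial is bounded on the
   large cube by its values at finitely many nodes of the small one, and the
   nodes may be chosen where its square is at most its mean. *)
Require Import Defs.
From HB Require Import structures.
From mathcomp Require Import all_boot all_order all_algebra.
From mathcomp Require Import ring lra.
From mathcomp Require Import -(notations) mpoly.
From mathcomp Require Import all_classical all_reals all_analysis.
From mathcomp Require Import measurable_realfun.
Import Order.TTheory GRing.Theory Num.Theory.
Import numFieldNormedType.Exports.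
Local Open Scope classical_set_scope.
Local Open Scope ring_scope.

Set Implicit Arguments.
Unset Strict Implicit.
Unset Printing Implicit Defensive.

(** * Univariate polynomials bounded by their values at separated nodes *)

(** The spatial domain is only open, connected, nonempty and bounded, so no divergence theorem and
    no regularity of its boundary can be invoked; on lines, the one-dimensional fundamental theorem
    replaces both. A line meets a convex element in an interval, hence has finitely many
    breakpoints. The boundary of a bounded convex set with interior points is null, so by Tonelli
    almost every characteristic meets the mesh skeleton in a null set of times. Elements are
    arbitrary convex polytopes, so there is no reference element to scale to. Comparison with cubes
    gives an inverse inequality whose constant depends only on [d], [r] and the ratio of the two
    cubes; [sigma] and [kappa] control this ratio, and that is what makes the final constant
    independent of [h]. Young's inequality leaves exactly half of the stabilization, whence the
    coercivity constant [theta / 2]. The threshold for [theta] is [1 / (alpha * K + 1)], where [K]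
    is the constant in h^2 |Delta v|^2 <= K |grad v|^2 over the whole cylinder. *)

Fixpoint node_bound (R : realType) (A g : R) (n : nat) : R :=
  if n is k.+1 then 1 + (2 * A + 1) * node_bound A g k * (2 / g) else 1.

Lemma node_bound_ge1 (R : realType) (A g : R) n : 0 <= A -> 0 < g ->
  1 <= node_bound A g n.
Proof.
move=> A0 g0; elim: n => //= n IH.
rewrite lerDl !mulr_ge0 ?invr_ge0 ?(ltW g0) ?addr_ge0 ?mulr_ge0 //.
exact: le_trans ler01 IH.
Qed.

(* Newton form: [q = q(x) + (X - x) q1], and [q1] takes the values
   [(q(y) - q(x)) / (y - x)] at the remaining nodes. *)
Lemma poly_bound_nodes (R : realType) (A g m : R) (xs : seq R) (q : {poly R}) (z : R) :
  0 < g -> 0 <= m ->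
  (size q <= size xs)%N -> pairwise (fun x y => g <= `|x - y|) xs ->
  {in xs, forall x, `|x| <= A} -> {in xs, forall x, `|q.[x]| <= m} ->
  `|z| <= A ->
  `|q.[z]| <= node_bound A g (size xs) * m /\
  `|q^`().[z]| <= node_bound A g (size xs) * m.
Proof.
move=> g0 + + + + + zA.
have A0 : 0 <= A by apply: le_trans zA.
elim: xs q m => [|x xs IH] q m m0 /=.
  by rewrite leqn0 size_poly_eq0 => /eqP-> *; rewrite deriv0 horner0 normr0 mul1r.
move=> sq /andP[/allP xg sep] nA nq.
have xA : `|x| <= A by apply: nA; rewrite inE eqxx.
have qx : `|q.[x]| <= m by apply: nq; rewrite inE eqxx.
have [q1 qE] : exists q1 : {poly R}, q = q.[x]%:P + ('X - x%:P) * q1.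
  have : root (q - q.[x]%:P) x by rewrite /root !hornerE subrr.
  by case/factor_theorem => q1 qE; exists q1; rewrite mulrC -qE addrC subrK.
have sq1 : (size q1 <= size xs)%N.
  have [->|q10] := eqVneq q1 0; first by rewrite size_poly0.
  have : (size (('X - x%:P) * q1)%R <= (size xs).+1)%N.
    have -> : ('X - x%:P) * q1 = q - q.[x]%:P by rewrite [X in _ = X - _]qE [RHS]addrAC subrr add0r.
    rewrite (leq_trans (size_polyD _ _))// geq_max sq size_polyN.
    by rewrite (leq_trans (size_polyC_leq1 _)).
  by rewrite size_monicM ?monicXsubC// size_XsubC.
have q1b : {in xs, forall y, `|q1.[y]| <= 2 / g * m}.
  move=> y yxs; have gy := xg _ yxs.
  have qy : `|q.[y]| <= m by apply: nq; rewrite inE yxs orbT.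
  have : `|q.[y] - q.[x]| <= 2 * m.
    by rewrite (le_trans (ler_normB _ _))// [2 * m]mulr_natl mulr2n lerD.
  have -> : q.[y] - q.[x] = (y - x) * q1.[y] by rewrite qE !hornerE; ring.
  rewrite normrM distrC => H.
  rewrite mulrAC ler_pdivlMr// mulrC.
  by apply: le_trans H; apply: ler_wpM2r.
have [B0 B1] := IH q1 (2 / g * m) (mulr_ge0 (divr_ge0 (ler0n _ 2) (ltW g0)) m0) sq1 sep
  (fun y yx => nA y (@mem_behead _ (x :: xs) y yx)) q1b.
set K := node_bound A g (size xs) in B0 B1 *.
have zx : `|z - x| <= 2 * A.
  by rewrite (le_trans (ler_normB _ _))// [2 * A]mulr_natl mulr2n lerD.
have K1 : 1 <= K by exact: node_bound_ge1.
have Km : 0 <= K * (2 / g * m).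
  by rewrite !mulr_ge0 ?invr_ge0 ?(ltW g0)// (le_trans ler01).
(* At [z] the value costs [m + 2 * A * (K * (2 / g * m))], the derivative
   [(1 + 2 * A) * (K * (2 / g * m))]; the recursion of [node_bound] is large enough for both. *)
split.
- have -> : q.[z] = q.[x] + (z - x) * q1.[z] by rewrite {1}qE !hornerE.
  apply: le_trans (ler_normD _ _) _; rewrite normrM.
  have := ler_pM (normr_ge0 _) (normr_ge0 _) zx B0; nra.
- have -> : q^`().[z] = q1.[z] + (z - x) * q1^`().[z].
    by rewrite {1}qE derivD derivC derivM derivXsubC !hornerE.
  apply: le_trans (ler_normD _ _) _; rewrite normrM.
  have := ler_pM (normr_ge0 _) (normr_ge0 _) zx B1; nra.
Qed.
(** The substitution x = c + a y reduces to unit scale. The chain rule puts the factor [a] in front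
    of the derivative, and this is the origin of the power of [h] in the inverse inequality. *)
Lemma poly_bound_nodes_scaled (R : realType) (A g m a c : R) (xs : seq R)
    (q : {poly R}) (z : R) :
  0 < g -> 0 <= m -> 0 < a ->
  (size q <= size xs)%N -> pairwise (fun x y => g * a <= `|x - y|) xs ->
  {in xs, forall x, `|x - c| <= A * a} -> {in xs, forall x, `|q.[x]| <= m} ->
  `|z - c| <= A * a ->
  `|q.[z]| <= node_bound A g (size xs) * m /\
  a * `|q^`().[z]| <= node_bound A g (size xs) * m.
Proof.
move=> g0 m0 a0 sq sep nA nq zA.
have an0 : a != 0 by rewrite gt_eqF.
pose l : {poly R} := a *: 'X + c%:P.
have lE x : (q \Po l).[(x - c) / a] = q.[x].
  by rewrite horner_comp /l hornerD hornerZ hornerX hornerC mulrCA mulfV// mulr1 subrK.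
have nE x : `|(x - c) / a| = `|x - c| / a by rewrite normrM (gtr0_norm (x := a^-1)) ?invr_gt0.
have sl : size l = 2.
  rewrite size_polyDl size_scale// size_polyX//.
  by rewrite (leq_ltn_trans (size_polyC_leq1 _)).
rewrite -(size_map (fun x => (x - c) / a) xs).
have := @poly_bound_nodes R A g m (map (fun x => (x - c) / a) xs) (q \Po l) ((z - c) / a) g0 m0.
case.
- rewrite size_map; apply: leq_trans sq; by rewrite size_comp_poly2.
- rewrite pairwise_map; apply: sub_pairwise sep => x y /=.
  rewrite -mulrBl opprB addrA subrK normrM (gtr0_norm (x := a^-1)) ?invr_gt0//.
  by rewrite ler_pdivlMr.
- by move=> _ /mapP[x xxs ->]; rewrite nE ler_pdivrMr//; exact: nA.
- by move=> _ /mapP[x xxs ->]; rewrite lE; exact: nq.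
- by rewrite nE ler_pdivrMr.
- rewrite lE => B0; rewrite deriv_comp hornerM horner_comp => B1; split=> //.
  apply: le_trans B1.
  have lz : l.[(z - c) / a] = z.
    by rewrite /l hornerD hornerZ hornerX hornerC mulrCA mulfV// mulr1 subrK.
  have dl : l^`() = a%:P by rewrite /l derivD derivZ derivX derivC addr0 alg_polyC.
  by rewrite lz dl hornerC normrM (gtr0_norm a0) mulrC.
Qed.

(** A continuous function attains its minimum on a compact interval, and the minimum is at most the
    mean. *)
Lemma sqr_poly_le_mean (R : realType) (q : {poly R}) (u v : R) : u < v ->
  exists2 x, u <= x <= v &
  (((v - u) * q.[x] ^+ 2)%:E
    <= \int[@lebesgue_measure R]_(y in `[u, v]) (q.[y] ^+ 2)%:E)%E.
Proof.
move=> uv.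
have cq : continuous (fun y => q.[y] ^+ 2).
  move=> y; under eq_fun do rewrite -horner_exp; exact: continuous_horner.
have [x xuv xm] := EVT_min (ltW uv) (continuous_subspaceT cq).
exists x; first by rewrite in_itv in xuv.
have -> : ((v - u) * q.[x] ^+ 2)%:E =
   (\int[@lebesgue_measure R]_(y in `[u, v]) (q.[x] ^+ 2)%:E)%E.
  rewrite integral_cst//= lebesgue_measure_itv/= lte_fin uv EFinM muleC.
  by rewrite -EFinB.
apply: ge0_le_integral => //.
- by move=> y _; rewrite lee_fin sqr_ge0.
- apply/measurable_EFinP; apply: measurable_funTS; exact: continuous_measurable_fun.

Qed.

(** With w = a / (r + 1), the interval of length 2 a around [c] is cut into 2 (r + 1) cells of
    length w. Every other cell is kept, shifted by w / 2 so that all [r + 1] of them lie strictly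
    inside the open interval. *)
Definition node_left (R : realType) (r : nat) (a c : R) (k : nat) : R :=
  c - a + (k.*2%:R + 2^-1) * (a / r.+1%:R).

Lemma node_left_bounds (R : realType) (r : nat) (a c : R) (k : nat) :
  0 < a -> (k <= r)%N ->
  c - a < node_left r a c k /\ node_left r a c k + a / r.+1%:R < c + a.
Proof.
move=> a0 kr; rewrite /node_left.
set w := a / r.+1%:R.
have w0 : 0 < w by rewrite divr_gt0.
have k0 : 0 <= k.*2%:R :> R by rewrite ler0n.
have aw : a = (r%:R + 1) * w by rewrite natr1 mulrC divfK// pnatr_eq0.
have kr2 : k.*2%:R <= 2 * r%:R :> R.
  by rewrite -natrM ler_nat mul2n leq_double.
by split; nra.
Qed.

(** Two consecutive cells are a / (r + 1) apart, so any choice of one point in each gives separated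
    nodes. [sqr_poly_le_integral] chooses minimizers of the square, [poly_deriv_bound] left
    endpoints. *)
Lemma nodes_separated (R : realType) (r : nat) (a c : R) (x : nat -> R) :
  0 < a ->
  (forall k, (k <= r)%N ->
    node_left r a c k <= x k <= node_left r a c k + a / r.+1%:R) ->
  pairwise (fun y z => r.+1%:R^-1 * a <= `|y - z|) (mkseq x r.+1) /\
  {in mkseq x r.+1, forall y, `|y - c| <= a}.
Proof.
move=> a0 xk; split.
  apply/(pairwiseP 0) => i j; rewrite !inE size_mkseq => ir jr ij.
  rewrite !nth_mkseq//; have := xk i ir; have := xk j jr; rewrite /node_left.
  rewrite (mulrC _^-1); set w := a / r.+1%:R.
  have w0 : 0 < w by rewrite divr_gt0.
  have ij2 : i.*2%:R + 2 <= j.*2%:R :> R.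
    by rewrite -natrD ler_nat addn2 -doubleS leq_double.
  move=> /andP[h1 h2] /andP[h3 h4].
  by rewrite distrC ler_normr; apply/orP; left; nra.
move=> y /mapP[k]; rewrite mem_iota /= add0n ltnS => kr ->.
have /andP[h1 h2] := xk _ kr; have [h3 h4] := @node_left_bounds R r a c k a0 kr.
have := lt_le_trans h3 h1; have := le_lt_trans h2 h4; move: (x k) => t *.
by rewrite ler_norml; apply/andP; split; lra.
Qed.

(** In each cell, of length w = a / (r + 1), a node is taken where the square is at most its mean.
    With I the integral over the whole interval, all node values are at most sqrt (I / w), so q(z)^2
    a <= K^2 (I / w) a = K^2 (r + 1) I. *)
Lemma sqr_poly_le_integral (R : realType) (r : nat) (L : R) : 1 <= L ->
  exists2 M : R, 0 < M & forall (q : {poly R}) (a c z : R),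
  (size q <= r.+1)%N -> 0 < a -> `|z - c| <= L * a ->
  ((q.[z] ^+ 2 * a)%:E <=
   M%:E * \int[@lebesgue_measure R]_(y in `](c - a)%R, (c + a)%R[) (q.[y] ^+ 2)%:E)%E.
Proof.
move=> L1; have r0 : 0 < r.+1%:R^-1 :> R by rewrite invr_gt0.
have L0 : 0 <= L by apply: le_trans L1.
set K := node_bound L r.+1%:R^-1 r.+1.
have K1 : 1 <= K by exact: node_bound_ge1.
have K0 : 0 < K by exact: lt_le_trans K1.
have M0 : 0 < K ^+ 2 * r.+1%:R by rewrite mulr_gt0 ?exprn_gt0.
exists (K ^+ 2 * r.+1%:R) => // q a c z sq a0 zc.
have w0 : 0 < a / r.+1%:R by rewrite divr_gt0.
have I0 : (0 <= \int[@lebesgue_measure R]_(y in `](c - a)%R, (c + a)%R[) (q.[y] ^+ 2)%:E)%E.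
  by apply: integral_ge0 => y _; rewrite lee_fin sqr_ge0.
have nodeP k : exists y, (k <= r)%N ->
    node_left r a c k <= y <= node_left r a c k + a / r.+1%:R /\
    ((a / r.+1%:R * q.[y] ^+ 2)%:E <=
     \int[@lebesgue_measure R]_(y in `](c - a)%R, (c + a)%R[) (q.[y] ^+ 2)%:E)%E.
  have [kr|] := leqP k r; last by exists 0.
  have [h3 h4] := @node_left_bounds R r a c k a0 kr.
  have [|y yb yI] := @sqr_poly_le_mean R q (node_left r a c k)
    (node_left r a c k + a / r.+1%:R); first by rewrite ltrDl.
  exists y => _; split=> //; move: yI; rewrite addrAC subrr add0r => yI.
  apply: (le_trans yI); apply: ge0_subset_integral => //.
  - apply/measurable_EFinP; apply: measurable_funTS; apply: continuous_measurable_fun.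
    under eq_fun do rewrite -horner_exp; exact: continuous_horner.
  - by move=> t _; rewrite lee_fin sqr_ge0.
  - move=> t; rewrite /= !in_itv/= => /andP[h1 h2].
    by rewrite (lt_le_trans h3 h1) (le_lt_trans h2 h4).
(* The integral is an extended real; if it is infinite, the right-hand side is [+oo]. *)
move: I0 nodeP.
case: (\int[_]_(_ in _) _)%E => [I|_ _|//]; last first.
  by rewrite mulry gtr0_sg// mul1e leey.
rewrite lee_fin => I0 /choice[x xP].
set m := Num.sqrt (I / (a / r.+1%:R)).
have [sep nc] := @nodes_separated R r a c x a0 (fun k kr => (xP k kr).1).
have [||||qz _] := @poly_bound_nodes_scaled R L r.+1%:R^-1 m a c
    (mkseq x r.+1) q z r0 _ a0 _ sep _ _ zc.
- exact: sqrtr_ge0.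
- by rewrite size_mkseq.
- by move=> y /nc yc; rewrite (le_trans yc)// ler_peMl// ltW.
- move=> y /mapP[k]; rewrite mem_iota /= add0n ltnS => kr ->.
  have [_] := xP k kr; rewrite lee_fin => h.
  by rewrite -sqrtr_sqr ler_wsqrtr// ler_pdivlMr// mulrC.
rewrite -EFinM lee_fin.
move: qz; rewrite size_mkseq -/K => qz.
have : q.[z] ^+ 2 <= (K * m) ^+ 2.
  by rewrite -real_normK ?num_real// ler_pXn2r// nnegrE ?mulr_ge0 ?sqrtr_ge0// ltW.
rewrite exprMn sqr_sqrtr; last by rewrite divr_ge0 // ltW.
move=> qz2.
apply: le_trans (ler_wpM2r (ltW a0) qz2) _.
rewrite le_eqVlt; apply/orP; left; apply/eqP; field.
by rewrite nat1r pnatr_eq0 (gt_eqF a0).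
Qed.

Lemma poly_deriv_bound (R : realType) (r : nat) (L : R) : 1 <= L ->
  exists2 M : R, 0 < M & forall (q : {poly R}) (a c z m : R),
  (size q <= r.+1)%N -> 0 < a -> 0 <= m ->
  (forall x, `|x - c| <= a -> `|q.[x]| <= m) -> `|z - c| <= L * a ->
  a * `|q^`().[z]| <= M * m.
Proof.
move=> L1; have r0 : 0 < r.+1%:R^-1 :> R by rewrite invr_gt0.
have L0 : 0 <= L by apply: le_trans L1.
exists (node_bound L r.+1%:R^-1 r.+1).
  by rewrite (lt_le_trans ltr01)// node_bound_ge1.
move=> q a c z m sq a0 m0 qm zc.
have [|sep nc] := @nodes_separated R r a c (node_left r a c) a0.
  by move=> k kr; rewrite lexx lerDl divr_ge0// ltW.
have [|||_] := @poly_bound_nodes_scaled R L r.+1%:R^-1 m a c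
    (mkseq (node_left r a c) r.+1) q z r0 m0 a0 _ sep _ _ zc.
- by rewrite size_mkseq.
- by move=> y /nc yc; rewrite (le_trans yc)// ler_peMl// ltW.
- by move=> y /nc /qm.
by rewrite size_mkseq.
Qed.

(** * Fundamental theorem of calculus for piecewise polynomials *)

(** Continuity up to the ends identifies [F a] and [F b] with the values of [p]. Inside, [F] agrees
    with [p] near every point, so [G] is almost everywhere the derivative of [p], to which the
    classical theorem applies. *)
Lemma FTC_ae_poly (R : realType) (F G : R -> R) (p : {poly R}) (a b : R) :
  a < b -> {within `[a, b], continuous F} ->
  (forall x, a < x < b -> F x = p.[x]) ->
  measurable_fun `[a, b] G ->
  {ae @lebesgue_measure R, forall x, a < x < b -> 'D_1 F x = G x} ->
  \int[@lebesgue_measure R]_(x in `[a, b]) G x = F b - F a.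
Proof.
move=> ab cF Fp mG GE.
have [_ Fa Fb] := (continuous_within_itvP F ab).1 cF.
have cp := @continuous_horner R.
have pa : F a = p.[a].
  apply: (cvg_unique (@Rhausdorff R) Fa).
  apply: cvg_trans (cvg_at_right_filter (cp p a)).
  apply: near_eq_cvg; near=> x; apply/esym/Fp/andP; split; near: x.
    exact: nbhs_right_gt.
  exact: nbhs_right_lt.
have pb : F b = p.[b].
  apply: (cvg_unique (@Rhausdorff R) Fb).
  apply: cvg_trans (cvg_at_left_filter (cp p b)).
  apply: near_eq_cvg; near=> x; apply/esym/Fp/andP; split; near: x.
    exact: nbhs_left_gt.
  exact: nbhs_left_lt.
have mp : measurable_fun `[a, b] (EFin \o horner p^`()).
  apply/measurable_EFinP; apply: measurable_funTS.
  by apply: continuous_measurable_fun; exact: cp.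
have sub : `]a, b[%classic `<=` `[a, b]%classic by apply: subset_itvW.
have -> : \int[@lebesgue_measure R]_(x in `[a, b]) G x =
          \int[@lebesgue_measure R]_(x in `[a, b]) p^`().[x].
  rewrite /Rintegral; congr fine.
  have oo (f : R -> \bar R) : measurable_fun `[a, b] f ->
      (\int[@lebesgue_measure R]_(x in `[a, b]) f x =
       \int[@lebesgue_measure R]_(x in `]a, b[) f x)%E.
    by move=> mf; rewrite integral_itv_bndoo//; apply: measurable_funS mf.
  rewrite !oo//; last exact/measurable_EFinP.
  apply: ae_eq_integral => //.
  - by apply/measurable_EFinP; apply: measurable_funS mG.
  - by apply: measurable_funS mp.
  apply: (@filterS _ _ (ae_filter_ringOfSetsType _) _ _ _ GE) => x GEx; rewrite /= in_itv/= => xab; rewrite -GEx//; congr EFin.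
  have -> : 'D_1 F x = 'D_1 (horner p) x.
    apply: near_eq_derive; near=> y; apply: Fp.
    by rewrite -[_ && _]/(y \in `]a, b[); near: y; exact: near_in_itvoo.
  by rewrite derive_val.
rewrite /Rintegral (@continuous_FTC2 _ _ (horner p))//.
- by rewrite /= pa pb.
- exact/continuous_subspaceT/cp.
- split; first by move=> x _; exact: derivable_horner.
    exact/cvg_at_right_filter/cp.
  exact/cvg_at_left_filter/cp.
- by move=> x _; rewrite -derivE.
Unshelve. all: by end_near.
Qed.

(** Induction on the number of breakpoints, splitting at one of them. Asking for a polynomial on
    every subinterval that avoids [E] is inherited by both halves and does not require [E] to be
    sorted. *)
Lemma FTC_ae_piecewise_poly (R : realType) (E : seq R) (F G : R -> R) (a b : R) :
  a <= b -> {within `[a, b], continuous F} ->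
  (forall c d, a <= c -> c < d -> d <= b ->
     (forall e, e \in E -> ~~ (c < e < d)) ->
     exists p : {poly R}, forall x, c < x < d -> F x = p.[x]) ->
  (@lebesgue_measure R).-integrable `[a, b] (EFin \o G) ->
  {ae @lebesgue_measure R, forall x, a < x < b -> 'D_1 F x = G x} ->
  \int[@lebesgue_measure R]_(x in `[a, b]) G x = F b - F a.
Proof.
have [n] := ubnP (size E); elim: n => // n IH in E a b *.
move=> sE; rewrite le_eqVlt => /predU1P[->|ab] cF Fp iG GE.
  by rewrite subrr set_itv1 Rintegral_set1.
have mG : measurable_fun `[a, b] G by apply/measurable_EFinP; exact: measurable_int iG.
have [/hasP[e eE /andP[ae eb]]|/hasPn nE] := boolP (has (fun e => a < e < b) E); last first.
  have [p Fp'] := Fp a b (lexx _) ab (lexx _) nE.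
  exact: FTC_ae_poly Fp' mG GE.
have sae : `[a, e]%classic `<=` `[a, b]%classic.
  by apply: subset_itvl; rewrite bnd_simp ltW.
have seb : `[e, b]%classic `<=` `[a, b]%classic.
  by apply: subset_itvr; rewrite bnd_simp ltW.
have sr : (size (rem e E) < n)%N.
  by rewrite size_rem//; case: {Fp} E eE sE.
have I1 : \int[@lebesgue_measure R]_(x in `[a, e]) G x = F e - F a.
  apply: (IH (rem e E)) => //; first exact: ltW.
  - exact: continuous_subspaceW cF.
  - move=> c d ac cd de nE; apply: Fp => //; first by rewrite (le_trans de)// ltW.
    (* The removed breakpoint [e] is an end of the half interval, so it never lies strictly inside a
       piece of that half. *)
    move=> x xE; have [->|xe] := eqVneq x e.
      by rewrite negb_and -!leNgt de orbT.
    by apply: nE; rewrite rem_mem.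
  - exact: integrableS iG.
  - apply: (@filterS _ _ (ae_filter_ringOfSetsType _) _ _ _ GE) => x GEx /andP[ax xe].
    by apply: GEx; rewrite ax (lt_trans xe).
have I2 : \int[@lebesgue_measure R]_(x in `[e, b]) G x = F b - F e.
  apply: (IH (rem e E)) => //; first exact: ltW.
  - exact: continuous_subspaceW cF.
  - move=> c d ac cd de nE; apply: Fp => //; first by rewrite (le_trans _ ac)// ltW.
    move=> x xE; have [->|xe] := eqVneq x e.
      by rewrite negb_and -!leNgt ac.
    by apply: nE; rewrite rem_mem.
  - exact: integrableS iG.
  - apply: (@filterS _ _ (ae_filter_ringOfSetsType _) _ _ _ GE) => x GEx /andP[ax xe].
    by apply: GEx; rewrite xe (lt_trans ae).
have := @Rintegral_itvB R G (BLeft a) (BRight b) e iG.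
rewrite !bnd_simp => /(_ (ltW ae) (ltW eb)).
rewrite Rintegral_itv_obnd_cbnd; last first.
  by apply: integrableS iG => //; apply: subset_itvr; rewrite bnd_simp ltW.
rewrite I1 I2 => /eqP; rewrite subr_eq => /eqP->; ring.
Qed.

(** * Lebesgue measure on tuples *)

Lemma ge0_integral_lebS (R : realType) (n : nat)
    (f : n.+1.-tuple (measurableTypeR R) -> \bar R) :
  measurable_fun setT f -> (forall s, (0 <= f s)%E) ->
  (\int[leb R n.+1]_s f s =
   \int[@lebesgue_measure R]_x \int[leb R n]_s f (cons_pair (x, s)))%E.
Proof.
move=> mf f0.
rewrite (@ge0_integral_pushforward _ _ _ _ _ _ (@measurable_cons_pair R n))//.
rewrite preimage_setT fubini_tonelli1//; last by move=> x; exact: f0.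
by apply: measurableT_comp => //; exact: measurable_cons_pair.
Qed.

Lemma ge0_integral_lebS_swap (R : realType) (n : nat)
    (f : n.+1.-tuple (measurableTypeR R) -> \bar R) :
  measurable_fun setT f -> (forall s, (0 <= f s)%E) ->
  (\int[leb R n.+1]_s f s =
   \int[leb R n]_s \int[@lebesgue_measure R]_x f (cons_pair (x, s)))%E.
Proof.
move=> mf f0.
rewrite (@ge0_integral_pushforward _ _ _ _ _ _ (@measurable_cons_pair R n))//.
rewrite preimage_setT fubini_tonelli2//; last by move=> x; exact: f0.
by apply: measurableT_comp => //; exact: measurable_cons_pair.
Qed.

Lemma measurable_affine (R : realType) (c a : R) :
  measurable_fun setT (fun x : measurableTypeR R => c + a * x : measurableTypeR R).
Proof. by apply: measurable_funD => //; apply: measurable_funM. Qed.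

(** Both sides are measures in [A], and they agree on the half-open intervals, which determine
    Lebesgue measure. *)
Lemma lebesgue_measure_affine (R : realType) (a c : R) (A : set (measurableTypeR R)) :
  0 < a -> measurable A ->
  (a%:E * lebesgue_measure ((fun x => c + a * x)%R @^-1` A) = lebesgue_measure A)%E.
Proof.
move=> a0 mA.
pose m : {measure set (measurableTypeR R) -> \bar R} :=
  measure_function_pushforward__canonical__measure_function_Measure (@lebesgue_measure R) (measurable_affine c a).
pose k : {nonneg R} := NngNum (ltW a0).
transitivity (mscale k m A); first by [].
apply/esym; apply: lebesgue_measure_unique mA => _ [[u v]] _ <- /=.
rewrite lebesgue_measure_itv/= /mscale /= /pushforward.
rewrite (_ : _ @^-1` _ = [set` `](u - c) / a, (v - c) / a]]); last first.
  by apply/seteqP; split => x /=; rewrite !in_itv/= ltr_pdivrMr// ler_pdivlMr//;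
    rewrite ltrBlDl lerBrDl (mulrC x).
rewrite lebesgue_measure_itv/= !lte_fin ltr_pM2r ?invr_gt0// ltrD2r.
case: ifP => uv; last by rewrite mule0.
by rewrite -!EFinB -EFinM; congr EFin; field; rewrite gt_eqF.
Qed.

Lemma ge0_integral_affine (R : realType) (a c : R) (f : R -> \bar R) :
  0 < a -> measurable_fun setT f -> (forall x, (0 <= f x)%E) ->
  (a%:E * \int[@lebesgue_measure R]_x f (c + a * x)%R =
   \int[@lebesgue_measure R]_x f x)%E.
Proof.
move=> a0 mf f0.
pose m : {measure set (measurableTypeR R) -> \bar R} :=
  measure_function_pushforward__canonical__measure_function_Measure (@lebesgue_measure R) (measurable_affine c a).
pose k : {nonneg R} := NngNum (ltW a0).
transitivity (\int[mscale k m]_x f x)%E; last first.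
  by apply: eq_measure_integral => A mA _ /=; exact: lebesgue_measure_affine.
rewrite ge0_integral_mscale//; congr (_ * _)%E.
have /= -> // := @ge0_integral_pushforward _ _ _ _ _ _ (measurable_affine c a)
  (@lebesgue_measure R) setT f measurableT mf.
Qed.

Lemma tnth_lift0 (T : Type) (n : nat) (c : n.+1.-tuple T) (j : 'I_n) :
  tnth c (lift ord0 j) = tnth [tuple of behead c] j.
Proof. by rewrite {1}(tuple_eta c) tnthS. Qed.

Definition affine_tuple (R : realType) (n : nat) (c : n.-tuple R) (a : R)
    (s : n.-tuple (measurableTypeR R)) : n.-tuple (measurableTypeR R) :=
  [tuple tnth c i + a * tnth s i | i < n].

Lemma measurable_affine_tuple (R : realType) (n : nat) (c : n.-tuple R) (a : R) :
  measurable_fun setT (affine_tuple c a).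
Proof.
apply/measurable_fun_tnthP => i.
rewrite (_ : _ \o _ = fun s => tnth c i + a * tnth s i); last first.
  by apply/funext => s /=; rewrite tnth_mktuple.
apply: measurable_funD => //; apply: measurable_funM => //.
exact: measurable_tnth.
Qed.

Lemma affine_tuple_cons (R : realType) (n : nat) (c : n.+1.-tuple R) (a x : R) 
    (s : n.-tuple (measurableTypeR R)) :
  affine_tuple c a (cons_pair (x, s)) =
  cons_pair (thead c + a * x, affine_tuple [tuple of behead c] a s).
Proof.
apply: eq_from_tnth => i; rewrite tnth_mktuple.
case: (unliftP ord0 i) => [j ->|->]; last by rewrite !tnth0.
by rewrite !tnthS tnth_mktuple tnth_lift0.
Qed.

Lemma measurable_cons_l (R : realType) (n : nat) (s : n.-tuple (measurableTypeR R)) :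
  measurable_fun setT (fun x : measurableTypeR R => cons_pair (x, s)).
Proof.
by apply: measurableT_comp; [exact: measurable_cons_pair|exact: pair2_measurable].
Qed.

Lemma measurable_integral_head (R : realType) (n : nat)
    (f : n.+1.-tuple (measurableTypeR R) -> \bar R) :
  measurable_fun setT f -> (forall s, (0 <= f s)%E) ->
  measurable_fun setT
    (fun s => \int[@lebesgue_measure R]_x f (cons_pair (x, s)))%E.
Proof.
move=> mf f0.
apply: (@measurable_fun_fubini_tonelli_G _ _ _ _ _ lebesgue_measure
  (f \o @cons_pair R n)); last by move=> x; exact: f0.
by apply: measurableT_comp => //; exact: measurable_cons_pair.
Qed.

(** By Tonelli with the first coordinate innermost, each coordinate contributes one factor [a]. The
    map serves as a translation when [a = 1] and as a homothety when [a < 1]. *)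
Lemma ge0_integral_leb_affine (R : realType) (n : nat) (c : n.-tuple R) (a : R)
    (f : n.-tuple (measurableTypeR R) -> \bar R) :
  0 < a -> measurable_fun setT f -> (forall s, (0 <= f s)%E) ->
  ((a ^+ n)%:E * \int[leb R n]_s f (affine_tuple c a s) = \int[leb R n]_s f s)%E.
Proof.
elim: n c f => [|n IH] c f a0 mf f0.
  by rewrite expr0 mul1e; apply: eq_integral => s _; congr f; rewrite (tuple0 s) [LHS]tuple0.
have mfa : measurable_fun setT (fun s => f (affine_tuple c a s)).
  by apply: (measurableT_comp mf); exact: measurable_affine_tuple.
rewrite !ge0_integral_lebS_swap//.
pose F s := (\int[@lebesgue_measure R]_x f (cons_pair (x, s)))%E.
have mF : measurable_fun setT F.
  exact: measurable_integral_head.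
have F0 s : (0 <= F s)%E by apply: integral_ge0.
rewrite -(IH [tuple of behead c] F a0 mF F0) exprSr EFinM -muleA; congr (_ * _)%E.
rewrite -ge0_integralZl//=; last 3 first.
- exact: (@measurable_integral_head _ _ (fun s => f (affine_tuple c a s))).
- by move=> s _; apply: integral_ge0.
- by rewrite lee_fin ltW.
apply: eq_integral => s _.
rewrite /F -(@ge0_integral_affine R a (thead c))//.
  by congr (_ * _)%E; apply: eq_integral => x _; rewrite affine_tuple_cons.
by apply: measurableT_comp => //; exact: measurable_cons_l.
Qed.

Definition box (R : realType) (n : nat) (c : n.-tuple R) (a : R) :
    set (n.-tuple (measurableTypeR R)) :=
  [set s | forall i, `|tnth s i - tnth c i| < a].

Lemma box_cons (R : realType) (n : nat) (c : n.+1.-tuple R) (a x : R)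
    (s : n.-tuple (measurableTypeR R)) :
  box c a (cons_pair (x, s)) <->
  `|x - thead c| < a /\ box [tuple of behead c] a s.
Proof.
split=> [b|[b0 b] i].
  split; first by have := b ord0; rewrite tnth0.
  move=> i; have := b (lift ord0 i); rewrite tnthS tnth_lift0; apply.
case: (unliftP ord0 i) => [j ->|->]; last by rewrite tnth0.
by rewrite tnthS tnth_lift0; exact: b.
Qed.

Lemma measurable_box (R : realType) (n : nat) (c : n.-tuple R) (a : R) :
  measurable (box c a).
Proof.
rewrite (_ : box c a = \bigcap_(i in [set: 'I_n]) [set s | `|tnth s i - tnth c i| < a]).
  apply: fin_bigcap_measurable => // i _.
  rewrite -[X in measurable X]setTI.
  apply: (@measurable_fun_ltr _ _ _ setT (fun s : n.-tuple (measurableTypeR R) => `|tnth s i - tnth c i|) (cst a)) => //.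
  apply: measurableT_comp => //; apply: measurable_funB => //.
  exact: measurable_tnth.
by apply/seteqP; split => [s sb i _|s sb i]; apply: sb.
Qed.

Lemma leb_box (R : realType) (n : nat) (c : n.-tuple R) (a : R) :
  0 < a -> leb R n (box c a) = ((2 * a) ^+ n)%:E.
Proof.
move=> a0; elim: n c => [|n IH] c.
  by rewrite expr0 /= diracE mem_set// => -[].
rewrite -[LHS]/(product_measure1 (@lebesgue_measure R) (leb R n) (@cons_pair R n @^-1` box c a)).
rewrite (_ : _ @^-1` _ = `](thead c - a)%R, (thead c + a)%R[%classic `*` box [tuple of behead c] a).
  rewrite product_measure1E//; last exact: measurable_box.
  rewrite IH exprS EFinM; congr (_ * _)%E.
  apply: etrans (lebesgue_measure_itv _) _.
  by rewrite /= lte_fin ltrD2l gtrN// -EFinB; congr EFin; ring.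
by apply/seteqP; split => -[x s]; rewrite /preimage/= box_cons ltr_distl in_itv/= andbC.
Qed.

(** Connects topology with the product sigma-algebra on tuples: the boxes with rational centre and
    radius 1 / (k + 1) are countably many, and those contained in [A] cover it. *)
Lemma measurable_box_open (R : realType) (n : nat)
    (A : set (n.-tuple (measurableTypeR R))) :
  (forall s, A s -> exists2 e, 0 < e & box s e `<=` A) -> measurable A.
Proof.
move=> Ao.
pose D (p : n.-tuple rat * nat) : set (n.-tuple (measurableTypeR R)) :=
  box [tuple ratr (tnth p.1 i) | i < n] p.2.+1%:R^-1.
rewrite (_ : A = \bigcup_p (if `[< D p `<=` A >] then D p else set0)).
  apply: countable_bigcupT_measurable; [exact: countableP|move=> p].
  by case: ifP => // _; exact: measurable_box.
apply/seteqP; split => [s As|s [p _]]; last by case: asboolP => // + Dp; apply.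
have [e e0 eA] := Ao s As.
have e20 : 0 < e / 2 by rewrite divr_gt0.
(* Two points of a box of radius 1 / (k + 1) differ by less than 2 / (k + 1), hence by less than
   [e], in each coordinate. *)
pose k := Num.truncn (e / 2)^-1.
have ke : k.+1%:R^-1 < e / 2.
  rewrite invf_plt ?posrE//; exact: truncnS_gt.
have qP (i : 'I_n) : exists q : rat, `|tnth s i - ratr q| < k.+1%:R^-1.
  have [|q] := @rat_in_itvoo R (tnth s i - k.+1%:R^-1) (tnth s i + k.+1%:R^-1).
    by rewrite ltrD2l gtrN// invr_gt0.
  by rewrite in_itv/= -ltr_distlC => qs; exists q.
have [q qs] := choice qP.
exists ([tuple q i | i < n], k) => //.
have Ds : D ([tuple q i | i < n], k) s by move=> i; rewrite !tnth_mktuple.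
rewrite asboolT// => t Dt; apply: eA => i.
have := Dt i; have := Ds i; set x := tnth [tuple _ | _ < _] _ => sx tx.
have := ltrD tx sx; rewrite [X in _ < X -> _](_ : _ = 2 * k.+1%:R^-1); last by ring.
move=> h; apply: (@lt_trans _ _ (2 * k.+1%:R^-1)); last by rewrite mulrC -ltr_pdivlMr.
apply: le_lt_trans h; rewrite -[tnth t i - _](subrKA x).
by apply: le_trans (ler_normD _ _) _; rewrite (distrC x).
Qed.

(** Time is the head of the tuple, so the recursion step of [leb] is exactly the splitting of
    space-time into time and space. *)
Definition spt (R : realType) (d : nat) (s : d.+1.-tuple (measurableTypeR R)) :
  'rV[R]_d * R := (vec [tuple of behead s], thead s).

Definition coords (R : realType) (d : nat) (z : 'rV[R]_d * R) :
    d.+1.-tuple (measurableTypeR R) :=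
  cons_pair (z.2, [tuple z.1 0 i | i < d]).

Lemma spt_cons (R : realType) (d : nat) (t : R) (s : d.-tuple (measurableTypeR R)) :
  spt (cons_pair (t, s)) = (vec s, t).
Proof. by rewrite /spt /= theadE; congr (vec _, _); apply/val_inj. Qed.

Lemma coordsK (R : realType) (d : nat) : cancel (@coords R d) (@spt R d).
Proof.
move=> [x t]; rewrite /coords spt_cons; congr pair.
by apply/rowP => i; rewrite mxE tnth_mktuple.
Qed.

Lemma spt_affine (R : realType) (d : nat) (z : 'rV[R]_d * R) (a : R)
    (s : d.+1.-tuple (measurableTypeR R)) :
  spt (affine_tuple (coords z) a s) = z + a *: spt s.
Proof.
case: z => x t; congr pair.
  apply/rowP => i; rewrite !mxE -!tnth_lift0 tnth_mktuple tnth_lift0.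
  by congr (_ + _); rewrite -tnth_lift0 /coords tnthS tnth_mktuple.
by rewrite /thead tnth_mktuple /coords tnth0.
Qed.

Lemma open_measurable_spt (R : realType) (d : nat) (U : set ('rV[R]_d * R)) :
  open U -> measurable (@spt R d @^-1` U).
Proof.
move=> oU; apply: measurable_box_open => s Us.
have /nbhs_ballP[e /= e0 eU] := open_nbhs_nbhs (conj oU Us).
exists e => // t bt; apply: eU; split => /=.
  split=> // i j; rewrite (ord1 i) !mxE -!tnth_lift0 /ball/=.
  by rewrite distrC; exact: bt.
by rewrite /ball/= distrC; exact: bt.
Qed.

Lemma open_measurable_vec (R : realType) (d : nat) (U : set 'rV[R]_d) :
  open U -> measurable (@vec R d @^-1` U).
Proof.
move=> oU; apply: measurable_box_open => s Us.
have /nbhs_ballP[e /= e0 eU] := open_nbhs_nbhs (conj oU Us).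
exists e => // t bt; apply: eU; split=> // i j.
by rewrite (ord1 i) !mxE /ball/= distrC; exact: bt.
Qed.

Lemma closed_measurable_spt (R : realType) (d : nat) (U : set ('rV[R]_d * R)) :
  closed U -> measurable (@spt R d @^-1` U).
Proof.
move=> cU; rewrite -(setCK U) -preimage_setC; apply: measurableC.
by apply: open_measurable_spt; exact: closed_openC.
Qed.

(** * Boundaries of convex sets *)

Lemma bernoulli_le (R : realType) (e : R) n : 0 <= e <= 1 ->
  1 - n%:R * e <= (1 - e) ^+ n.
Proof.
move=> /andP[e0 e1]; elim: n => [|n IH]; first by rewrite mul0r subr0 expr0.
rewrite exprS; apply: le_trans (ler_wpM2l _ IH); last by rewrite subr_ge0.
have n0 : 0 <= n%:R :> R by rewrite ler0n.
by rewrite -natr1; nra.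
Qed.

Definition convexset (R : realType) (d : nat) (K : set ('rV[R]_d * R)) : Prop :=
  forall z1 z2 (w : R), K z1 -> K z2 -> 0 <= w <= 1 -> K (w *: z1 + (1 - w) *: z2).

(** Replace [z] by a nearby point z' of [K]. A point [w] near the combination is then
    [a *: z' + (1 - a) *: c'], with c' so close to [c] that it lies in the ball of [K] around
    [c]. *)
Lemma convex_interior (R : realType) (d : nat) (K : set ('rV[R]_d * R)) c z (a : R) :
  convexset K -> K° c -> closure K z -> 0 <= a < 1 -> K° (a *: z + (1 - a) *: c).
Proof.
move=> cK /nbhs_ballP[e /= e0 eK] clz /andP[a0 a1].
have b0 : 0 < 1 - a by rewrite subr_gt0.
(* Solving for c' divides by [1 - a] an error made of two parts, each at most [del]; hence the
   distance from c' to [c] stays below [e]. *)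
pose del := (1 - a) * e / 2.
have del0 : 0 < del by rewrite divr_gt0// mulr_gt0.
have [z' [Kz' zz']] := clz _ (nbhsx_ballx z del del0).
apply/nbhs_ballP; exists del => // w bw.
rewrite -ball_normE/= in zz'; rewrite -ball_normE/= in bw.
pose c' := (1 - a)^-1 *: (w - a *: z').
have -> : w = a *: z' + (1 - a) *: c'.
  by rewrite scalerA mulfV ?gt_eqF// scale1r addrC subrK.
apply: cK => //; last by rewrite a0 ltW.
apply: eK; rewrite -ball_normE/=.
have -> : c - c' = (1 - a)^-1 *: ((a *: z + (1 - a) *: c - w) - a *: (z - z')).
  have b1 : 1 - a != 0 by rewrite gt_eqF.
  rewrite -[c in LHS](scalerK b1) -scalerBr; congr (_ *: _).
  rewrite scalerBr; move: (a *: z) (a *: z') ((1 - a) *: c) => p q u.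
  rewrite !opprB [p + u]addrC -!addrA; congr (_ + _).
  by rewrite addrCA (addrCA p) subrr addr0 addrC.
rewrite normrZ gtr0_norm ?invr_gt0// mulrC ltr_pdivrMr//.
apply: le_lt_trans (ler_normB _ _) _; rewrite normrZ ger0_norm//.
have : a * `|z - z'| <= `|z - z'| by rewrite ler_piMl// ltW.
move: bw zz'; rewrite /del; set u := `|_|; set v := `|_|.
move=> *; lra.
Qed.

(** The passage to the limit [a -> 1], made quantitative by Bernoulli's inequality: [del] is chosen
    below 1 with [n%:R * del * x <= e]. *)
Lemma le_of_exprn_mul (R : realType) (n : nat) (x y : R) : 0 <= x ->
  (forall a, 0 < a < 1 -> a ^+ n * x <= y) -> x <= y.
Proof.
move=> x0 H; apply/ler_addgt0Pr => e e0.
pose m : R := n.+1%:R.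
have m1 : 1 <= m by rewrite ler1n.
have nm : n%:R <= m by rewrite ler_nat.
have D0 : 0 < m * (x + 1 + e) by nra.
pose del := e / (m * (x + 1 + e)).
have delE : del * (m * (x + 1 + e)) = e by rewrite divfK// gt_eqF.
have del0 : 0 < del by rewrite divr_gt0.
have del1 : del < 1 by rewrite ltr_pdivrMr// mul1r; nra.
have /H xy : 0 < 1 - del < 1 by apply/andP; split; lra.
have : 1 - n%:R * del <= (1 - del) ^+ n by apply: bernoulli_le; rewrite !ltW.
move=> /(ler_wpM2r x0) h.
have h3 : n%:R * (del * x) <= m * (del * x) by apply: ler_wpM2r => //; rewrite mulr_ge0// ltW.
have h4 : 0 < del * m by rewrite mulr_gt0// (lt_le_trans ltr01).
nra.
Qed.

(* The homothety of ratio [a < 1] centered at an interior point maps the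
   closure of [K] into its interior, so the measure of the closure is at most
   [a^-(d+1)] times that of the interior. *)
Lemma convex_boundary_null (R : realType) (d : nat) (K : set ('rV[R]_d * R))
    (b : d.+1.-tuple R) (B : R) :
  convexset K -> K° !=set0 -> @spt R d @^-1` closure K `<=` box b B ->
  leb R d.+1 (@spt R d @^-1` (closure K `\` K°)) = 0%E.
Proof.
move=> cK [c Kc] KB.
set A := @spt R d @^-1` closure K; set I := @spt R d @^-1` K°.
have mA : measurable A by apply: closed_measurable_spt; exact: closed_closure.
have mI : measurable I by apply: open_measurable_spt; exact: open_interior.
have IA : I `<=` A by move=> s /interior_subset /subset_closure.
have B0 : 0 < B.
  have := KB (coords c); rewrite /box/=.
  rewrite /preimage/= coordsK => /(_ (subset_closure (interior_subset Kc)) ord0).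
  by apply: le_lt_trans.
have Afin : (leb R d.+1 A < +oo)%E.
  apply: (@le_lt_trans _ _ (leb R d.+1 (box b B))).
    by apply: le_measure; rewrite ?inE//; exact: measurable_box.
  by rewrite leb_box// ltry.
have scale (a : R) : 0 < a < 1 -> ((a ^+ d.+1)%:E * leb R d.+1 A <= leb R d.+1 I)%E.
  move=> /andP[a0 a1].
  have indI (S : set _) : measurable S ->
      (leb R d.+1 S = \int[leb R d.+1]_s (\1_S s)%:E)%E.
    by move=> mS; rewrite integral_indic// setIT.
  (* The measure of [I] is a^(d+1) times that of its preimage under the homothety, and this preimage
     contains [A]. *)
  rewrite (indI I)// -(ge0_integral_leb_affine (coords ((1 - a) *: c)) a0)//; last first.
    by apply: measurableT_comp => //; exact: measurable_indic.
  apply: lee_wpmul2l; first by rewrite lee_fin exprn_ge0// ltW.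
  have mAI : measurable ((affine_tuple (coords ((1 - a) *: c)) a) @^-1` I).
    by rewrite -[X in measurable X]setTI; exact: measurable_affine_tuple.
  rewrite -[leRHS]/(\int[leb R d.+1]_s (\1_((affine_tuple (coords ((1 - a) *: c)) a) @^-1` I) s)%:E)%E.
  rewrite integral_indic// setIT; apply: le_measure; rewrite ?inE// => s As.
  rewrite /I /preimage/= spt_affine addrC.
  by apply: convex_interior => //; rewrite a1 ltW.
have Ifin : (leb R d.+1 I < +oo)%E by apply: le_lt_trans Afin; apply: le_measure; rewrite ?inE.
(* Here [a] tends to 1; both measures are finite since the closure lies in a box. *)
have key : (leb R d.+1 A <= leb R d.+1 I)%E.
  have fA : leb R d.+1 A \is a fin_num by rewrite ge0_fin_numE.
  have fI : leb R d.+1 I \is a fin_num by rewrite ge0_fin_numE.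
  rewrite -(fineK fA) -(fineK fI) lee_fin.
  apply: (@le_of_exprn_mul _ d.+1); first exact: fine_ge0.
  by move=> a /scale; rewrite -(fineK fA) -(fineK fI) -EFinM lee_fin.
rewrite -[LHS]/(leb R d.+1 (A `\` I)).
have -> : leb R d.+1 (A `\` I) = (leb R d.+1 A - leb R d.+1 (A `&` I))%E by rewrite measureD.
rewrite (setIidr IA).
have -> : leb R d.+1 A = leb R d.+1 I.
  by apply/eqP; rewrite eq_le key /=; apply: le_measure; rewrite ?inE.
by rewrite subee// ge0_fin_numE.
Qed.

(** * Pointwise bounds of polynomials by integrals over cubes *)

Lemma cons_pair_eta (R : realType) (n : nat) (s : n.+1.-tuple (measurableTypeR R)) :
  s = cons_pair (thead s, [tuple of behead s]).
Proof. by rewrite {1}(tuple_eta s); apply/val_inj. Qed.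

(* Polynomial of degree at most [r] in each variable separately. *)
Fixpoint slice_poly (R : realType) (r n : nat) :
    (n.-tuple (measurableTypeR R) -> R) -> Prop :=
  if n is m.+1 return (n.-tuple (measurableTypeR R) -> R) -> Prop
  then fun f =>
    (forall s, exists2 q : {poly R}, (size q <= r.+1)%N &
       forall x, f (cons_pair (x, s)) = q.[x]) /\
    forall x, slice_poly r (fun s => f (cons_pair (x, s)))
  else fun=> True.

Lemma measurable_cons_r (R : realType) (n : nat) (x : R) :
  measurable_fun setT (fun s : n.-tuple (measurableTypeR R) => cons_pair (x, s)).
Proof.
by apply: (measurableT_comp (@measurable_cons_pair R n)); exact: pair1_measurable.
Qed.

Lemma integral_box_cons (R : realType) (n : nat) (c : n.+1.-tuple R) (a : R)
    (f : n.+1.-tuple (measurableTypeR R) -> \bar R) :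
  measurable_fun setT f -> (forall s, (0 <= f s)%E) ->
  (\int[leb R n.+1]_(s in box c a) f s =
   \int[leb R n]_(s in box [tuple of behead c] a)
     \int[@lebesgue_measure R]_(x in `](thead c - a)%R, (thead c + a)%R[)
       f (cons_pair (x, s)))%E.
Proof.
move=> mf f0.
have f0' s : (0 <= (f \_ (box c a)) s)%E by rewrite patchE; case: ifP.
have mf' : measurable_fun setT (f \_ (box c a)).
  by apply/(measurable_restrictT _ _).1; [exact: measurable_box|exact: measurable_funTS].
rewrite integral_mkcond ge0_integral_lebS_swap// [RHS]integral_mkcond.
apply: eq_integral => s _; rewrite patchE.
case: ifPn => [|/negP] bs.
  rewrite [RHS]integral_mkcond; apply: eq_integral => x _.
  rewrite !patchE; congr (if _ then _ else _).
  rewrite inE in bs.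
  apply/idP/idP; rewrite !inE /= in_itv/= -ltr_distl.
    by move/box_cons => [].
  by move=> xc; apply/box_cons.
rewrite inE in bs.
rewrite integral0_eq// => x _; rewrite patchE ifF//.
by apply/negP; rewrite inE => /box_cons[].
Qed.

Lemma measurable_integral_head_in (R : realType) (n : nat) (D : set (measurableTypeR R))
    (f : n.+1.-tuple (measurableTypeR R) -> \bar R) :
  measurable D -> measurable_fun setT f -> (forall s, (0 <= f s)%E) ->
  measurable_fun setT
    (fun s => \int[@lebesgue_measure R]_(x in D) f (cons_pair (x, s)))%E.
Proof.
move=> mD mf f0.
pose D' : set (n.+1.-tuple (measurableTypeR R)) := (fun s => thead s) @^-1` D.
have mD' : measurable D'.
  by rewrite /D' -[X in measurable X]setTI; apply: measurable_tnth.
have mf' : measurable_fun setT (f \_ D').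
  by apply/(measurable_restrictT _ _).1 => //; exact: measurable_funTS.
have f0' s : (0 <= (f \_ D') s)%E by rewrite patchE; case: ifP.
rewrite (_ : (fun s => _) =
    (fun s => \int[@lebesgue_measure R]_x (f \_ D') (cons_pair (x, s)))%E).
  exact: measurable_integral_head.
apply/funext => s; rewrite integral_mkcond; apply: eq_integral => x _.
by rewrite !patchE; congr (if _ then _ else _).
Qed.

(** Induction on the dimension. The induction hypothesis is applied to the slice whose first
    coordinate is that of [z]; under its integral, the one-dimensional bound then trades this fixed
    coordinate for an integral over the side of the cube. The constants multiply. *)
Lemma sqr_le_integral_box (R : realType) (r n : nat) (L : R) : 1 <= L ->
  exists2 M : R, 0 < M &
  forall (f : n.-tuple (measurableTypeR R) -> R) (c z : n.-tuple R) (a : R),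
    measurable_fun setT f -> slice_poly r f -> 0 < a ->
    (forall i, `|tnth z i - tnth c i| <= L * a) ->
    ((f z ^+ 2 * a ^+ n)%:E <=
     M%:E * \int[leb R n]_(s in box c a) (f s ^+ 2)%:E)%E.
Proof.
move=> L1; have [M1 M10 HM1] := @sqr_poly_le_integral R r L L1.
elim: n => [|n [Mn Mn0 IH]].
  exists 1 => // f c z a mf _ a0 _.
  rewrite mul1e expr0 mulr1.
  rewrite (_ : box c a = setT); last by apply/seteqP; split => // s _ [].
  rewrite integral_dirac//; last first.
    by apply/measurable_EFinP; exact: measurable_funX.
  by rewrite diracT mul1e (tuple0 z).
exists (M1 * Mn) => [|f c z a mf [fp fs] a0 zc]; first by rewrite mulr_gt0.
rewrite integral_box_cons//; last 2 first.
- by apply/measurable_EFinP; exact: measurable_funX.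
- by move=> s; rewrite lee_fin sqr_ge0.
have fsq0 s : (0 <= (f s ^+ 2)%:E)%E by rewrite lee_fin sqr_ge0.
have mfsq : measurable_fun setT (fun s => (f s ^+ 2)%:E).
  by apply/measurable_EFinP; exact: measurable_funX.
have mg : measurable_fun setT (fun s => f (cons_pair (thead z, s))).
  by apply: measurableT_comp => //; exact: measurable_cons_r.
have := IH _ [tuple of behead c] [tuple of behead z] a mg (fs (thead z)) a0.
rewrite -(cons_pair_eta z) => H.
have {H}/H : forall i, `|tnth [tuple of behead z] i - tnth [tuple of behead c] i| <= L * a.
  by move=> i; rewrite -!tnth_lift0.
move=> /(lee_wpmul2l (_ : (0 <= a%:E)%E)); rewrite lee_fin => /(_ (ltW a0)).
rewrite -EFinM mulrCA -exprS => /le_trans; apply.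
have mbox' : measurable (box [tuple of behead c] a) by exact: measurable_box.
rewrite muleCA mulrC EFinM -muleA; apply: lee_wpmul2l; first by rewrite lee_fin ltW.
rewrite -!ge0_integralZl//; last 5 first.
- apply: measurable_funTS; exact: (@measurable_integral_head_in R n _ (fun s => (f s ^+ 2)%:E)).
- by move=> s _; apply: integral_ge0.
- by rewrite lee_fin ltW.
- by apply/measurable_EFinP; apply: measurable_funTS; exact: measurable_funX.
- by rewrite lee_fin ltW.
apply: ge0_le_integral => //.
- by move=> s _; rewrite -EFinM lee_fin mulr_ge0 ?sqr_ge0// ltW.
- apply: measurable_funTS; apply/measurable_EFinP; apply: measurable_funM => //.
  exact: measurable_funX.
- apply: measurable_funTS; apply: measurable_funeM.
  exact: (@measurable_integral_head_in R n _ (fun s => (f s ^+ 2)%:E)).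
move=> s sb; have [q sq qE] := fp s.
rewrite -EFinM qE mulrC.
under eq_integral do rewrite qE.
by apply: HM1 => //; exact: (zc ord0).
Qed.

(** * Invariance of the measure under translations and shears *)

Lemma integral_leb_translate (R : realType) (n : nat) (c : n.-tuple R)
    (f : n.-tuple (measurableTypeR R) -> \bar R) :
  measurable_fun setT f ->
  (\int[leb R n]_s f (affine_tuple c 1 s) = \int[leb R n]_s f s)%E.
Proof.
move=> mf; rewrite integralE [RHS]integralE.
have ge0 (g : n.-tuple (measurableTypeR R) -> \bar R) : measurable_fun setT g ->
    (forall s, (0 <= g s)%E) -> (\int[leb R n]_s g (affine_tuple c 1 s) = \int[leb R n]_s g s)%E.
  by move=> mg g0; rewrite -(ge0_integral_leb_affine c ltr01 mg g0) expr1n mul1e.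
congr (_ - _)%E.
  rewrite -(ge0 (f^\+)%E)//; last exact: measurable_funepos.
  by rewrite funepos.unlock.
rewrite -(ge0 (f^\-)%E)//; last exact: measurable_funeneg.
by rewrite funeneg.unlock.
Qed.

(** The pair (t, s) goes to the position at time t of the characteristic of velocity [b] that starts
    from s at time 0. *)
Definition shear (R : realType) (n : nat) (b : n.-tuple R) (p : R * n.-tuple (measurableTypeR R)) :
    n.+1.-tuple (measurableTypeR R) :=
  cons_pair (p.1, affine_tuple [tuple p.1 * tnth b i | i < n] 1 p.2).

Lemma measurable_shear (R : realType) (n : nat) (b : n.-tuple R) :
  measurable_fun setT (@shear R n b : (measurableTypeR R * n.-tuple (measurableTypeR R))%type -> _).
Proof.
apply: (measurableT_comp (@measurable_cons_pair R n)).
apply/measurable_fun_pairP; split; first exact: measurable_fst.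
apply/measurable_fun_tnthP => i.
rewrite (_ : _ \o _ = fun p : (measurableTypeR R * n.-tuple (measurableTypeR R))%type =>
    p.1 * tnth b i + tnth p.2 i); last first.
  by apply/funext => p /=; rewrite !tnth_mktuple mul1r.
apply: measurable_funD; first by apply: measurable_funM => //; exact: measurable_fst.
apply: (@measurableT_comp _ _ _ _ _ _ (fun x : n.-tuple (measurableTypeR R) => tnth x i)).
  exact: measurable_tnth.
exact: measurable_snd.
Qed.

Lemma ge0_integral_shear (R : realType) (n : nat) (b : n.-tuple R)
    (g : n.+1.-tuple (measurableTypeR R) -> \bar R) :
  measurable_fun setT g -> (forall s, (0 <= g s)%E) ->
  (\int[@lebesgue_measure R]_t \int[leb R n]_s g (shear b (t, s)) =
   \int[leb R n.+1]_s g s)%E.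
Proof.
move=> mg g0; rewrite ge0_integral_lebS//; apply: eq_integral => t _.
rewrite /shear /=.
apply: (@integral_leb_translate _ _ _ (fun s => g (cons_pair (t, s)))).
by apply: measurableT_comp => //; exact: measurable_cons_r.
Qed.

Lemma integrable_shear (R : realType) (n : nat) (b : n.-tuple R)
    (g : n.+1.-tuple (measurableTypeR R) -> \bar R) :
  (leb R n.+1).-integrable setT g ->
  (product_measure1 (@lebesgue_measure R) (leb R n)).-integrable setT (g \o shear b).
Proof.
move=> /integrableP[mg gi].
have ms := measurableT_comp mg (measurable_shear b).
apply/integrable12ltyP => //=.
have := @ge0_integral_shear R n b (fun s => `|g s|%E); rewrite /= => ->//.
exact: measurableT_comp.
Qed.

(** The left side integrates first along each characteristic. Fubini exchanges the order, and at a
    fixed time the shear is a translation in space. *)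
Lemma integral_shear (R : realType) (n : nat) (b : n.-tuple R)
    (g : n.+1.-tuple (measurableTypeR R) -> \bar R) :
  (leb R n.+1).-integrable setT g ->
  (\int[leb R n]_s \int[@lebesgue_measure R]_t g (shear b (t, s)) =
   \int[@lebesgue_measure R]_t \int[leb R n]_s g (cons_pair (t, s)))%E.
Proof.
move=> ig; have := Fubini (integrable_shear b ig) => /= <-.
apply: eq_integral => t _; rewrite /shear /=.
apply: (@integral_leb_translate _ _ _ (fun s => g (cons_pair (t, s)))).
apply: measurableT_comp; first exact: measurable_int ig.
exact: measurable_cons_r.
Qed.

(** Tonelli for the indicator of [A], read along characteristics: a nonnegative function with zero
    integral vanishes almost everywhere, first in the starting point, then in time. *)
Lemma null_shear (R : realType) (n : nat) (b : n.-tuple R) (A : set (n.+1.-tuple (measurableTypeR R))) :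
  measurable A -> leb R n.+1 A = 0%E ->
  {ae leb R n, forall s, {ae @lebesgue_measure R, forall t, ~ A (shear b (t, s))}}.
Proof.
move=> mA A0.
have mI : measurable_fun setT (fun s => (\1_A s : R)%:E).
  by apply/measurable_EFinP; exact: measurable_indic.
have mIs := measurableT_comp mI (measurable_shear b).
have : (\int[leb R n]_s \int[@lebesgue_measure R]_t (\1_A (shear b (t, s)))%:E = 0)%E.
  have I0 x : (0 <= ((fun s => (\1_A s : R)%:E) \o shear b) x)%E by rewrite lee_fin.
  have /= <- := @fubini_tonelli _ _ _ _ _ (@lebesgue_measure R) (leb R n) _ mIs I0.
  by rewrite (ge0_integral_shear b mI)// integral_indic// setIT.
set G := fun s => (\int[_]_t _)%E => G0.
have mG : measurable_fun setT G.
  apply: (@measurable_fun_fubini_tonelli_G _ _ _ _ _ (@lebesgue_measure R) _ mIs).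
  by move=> x /=; rewrite lee_fin.
have G_ge0 s : (0 <= G s)%E by apply: integral_ge0 => t _; rewrite lee_fin.
have : (\int[leb R n]_s `|G s| = 0)%E.
  by rewrite -[RHS]G0; apply: eq_integral => s _; rewrite gee0_abs.
move/(ae_eq_integral_abs _ measurableT mG).1.
apply: (@filterS _ _ (ae_filter_ringOfSetsType _)) => s /(_ Logic.I) Gs.
have mIt : measurable_fun setT (fun t : measurableTypeR R => (\1_A (shear b (t, s)) : R)%:E).
  exact: (measurableT_comp mIs (pair2_measurable s)).
have : (\int[@lebesgue_measure R]_t `|(\1_A (shear b (t, s)) : R)%:E| = 0)%E.
  by rewrite -[RHS]Gs; apply: eq_integral => t _; rewrite gee0_abs ?lee_fin.
move/(ae_eq_integral_abs (@lebesgue_measure R) measurableT mIt).1.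
apply: (@filterS _ _ (ae_filter_ringOfSetsType _)) => t /(_ Logic.I) /= + At.
by rewrite indicE mem_set// => -[] /eqP; rewrite oner_eq0.
Qed.

(** * Multivariate polynomials on lines and boxes *)

(** The induction along which differentiability, measurability and boundedness of [poly_eval] are
    proved. *)
Lemma mpoly_ring_ind (n : nat) (R : comNzRingType) (Q : mpoly n R -> Prop) :
  (forall c, Q (mpolyC n c)) -> (forall i, Q (mpolyX R (mnm1 i))) ->
  (forall p q, Q p -> Q q -> Q (p + q)) ->
  (forall p q, Q p -> Q q -> Q (p * q)) -> forall p, Q p.
Proof.
move=> QC QX QD QM p; rewrite [p]mpolyE.
elim/big_ind: _ => [||m _]; [by rewrite -[0]/(mpolyC n 0)|by []|].
rewrite -mul_mpolyC; apply: (QM _ _) => //; rewrite mpolyXE_id.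
elim/big_ind: _ => [||i _]; [exact: (QC 1)|exact: QM|].
elim: (m i) => [|k IH]; first by rewrite expr0; exact: (QC 1).
by rewrite exprS; apply: (QM _ _).
Qed.

(** Substituting univariate polynomials of degree at most 1 does not raise the degree. Affine [w]
    restrict [p] to a line; constants together with ['X] freeze some of the variables. *)
Lemma horner_meval (n r : nat) (R : comNzRingType) (p : mpoly n R)
    (w : 'I_n -> {poly R}) :
  (msize p <= r.+1)%N -> (forall i, size (w i) <= 2)%N ->
  exists2 q : {poly R}, (size q <= r.+1)%N &
    forall t, q.[t] = meval (fun i => (w i).[t]) p.
Proof.
move=> pr w2.
exists (\sum_(m <- msupp p) mcoeff m p *: \prod_(i < n) w i ^+ m i); last first.
  move=> t; rewrite horner_sum /meval /mmap; apply: eq_bigr => m _.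
  rewrite hornerZ horner_prod; congr (_ * _); apply: eq_bigr => i _.
  by rewrite horner_exp.
rewrite big_seq; apply: (@big_ind _ (fun q : {poly R} => size q <= r.+1)%N).
- by rewrite size_poly0.
- by move=> q1 q2 h1 h2; rewrite (leq_trans (size_polyD _ _))// geq_max h1.
move=> m mp; apply: leq_trans (size_scale_leq _ _) _.
apply: leq_trans (leq_trans (msize_mdeg_lt mp) pr).
rewrite mdegE; elim/big_rec2: _ => [|i k q _ kq]; first by rewrite size_poly1.
apply: leq_trans (size_polyMleq _ _) _.
have h : (size (w i ^+ m i)%R <= (m i).+1)%N.
  apply: leq_trans (size_poly_exp_leq _ _) _; rewrite ltnS.
  by rewrite -[leqRHS]mul1n leq_mul2r; case: (size (w i)) (w2 i) => [|[|[|k']]] //=; rewrite orbT.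
rewrite -subn1 leq_subLR add1n -addSn -addnS.
exact: leq_add.
Qed.

Lemma msize_mderiv (n r : nat) (R : comNzRingType) (p : mpoly n R) i :
  (msize p <= r.+1)%N -> (msize (mderiv i p) <= r.+1)%N.
Proof.
move=> pr; rewrite msizeE; apply/bigmax_leqP_seq => m mp _.
have : mnm_add m (mnm1 i) \in msupp p.
  move: mp; rewrite !mcoeff_msupp mcoeff_deriv; apply: contra => /eqP->.
  by rewrite mul0rn.
move=> /msize_mdeg_lt /leq_trans /(_ pr); rewrite mdegD mdeg1 addn1.
exact: ltnW.
Qed.

(** The numbering of variables used by [poly_eval]: time comes last, at [ord_max], whereas it is the
    head of the tuples of [spt]. *)
Definition xcoord (R : realType) (d : nat) (z : 'rV[R]_d * R) (i : 'I_d.+1) : R :=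
  if unlift ord_max i is Some j then z.1 0 j else z.2.

Lemma xcoord_affine (R : realType) (d : nat) (z a : 'rV[R]_d * R) (t : R) i :
  xcoord (z + t *: a) i = xcoord z i + t * xcoord a i.
Proof. by rewrite /xcoord; case: unlift => [j|] //=; rewrite !mxE. Qed.

Lemma poly_eval_line (R : realType) (d r : nat) (p : mpoly d.+1 R) z a :
  (msize p <= r.+1)%N ->
  exists2 q : {poly R}, (size q <= r.+1)%N &
    forall t, poly_eval p (z + t *: a) = q.[t].
Proof.
move=> pr; have [i|q sq qE] := @horner_meval _ _ _ p
    (fun i => (xcoord z i)%:P + xcoord a i *: 'X) pr.
  rewrite (leq_trans (size_polyD _ _))// geq_max (leq_trans (size_polyC_leq1 _))//.
  by rewrite (leq_trans (size_scale_leq _ _))// size_polyX.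
exists q => // t; rewrite qE; apply: meval_eq => i.
by rewrite -[LHS]/(xcoord (z + t *: a) i) xcoord_affine hornerD hornerC hornerZ hornerX mulrC.
Qed.

(** The two derivatives are limits of the same difference quotient. *)
Lemma is_derive_line (R : realType) (V W : normedModType R) (f : V -> W) z a t df :
  is_derive (z + t *: a) a f df <->
  is_derive (t : R) (1 : R) (fun t => f (z + t *: a)) df.
Proof.
have E : (fun h : R => h^-1 *: ((f \o shift (z + t *: a)) (h *: a) - f (z + t *: a))) =
    (fun h : R => h^-1 *: (((fun t => f (z + t *: a)) \o shift t) (h *: (1 : R)) - f (z + t *: a))).
  apply/funext => h; rewrite /shift /=; congr (_ *: (f _ - _)).
  have -> : h%:A = h :> R by exact: mulr1.
  by rewrite scalerDl addrCA.
have D1 : derivable f (z + t *: a) a = derivable (fun t : R => f (z + t *: a)) t 1.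
  by rewrite /derivable E.
have D2 : 'D_a f (z + t *: a) = 'D_1 (fun t : R => f (z + t *: a)) t.
  by rewrite /derive E.
by split=> -[h1 h2]; split; rewrite -?D1 -?D2// ?D1 ?D2.
Qed.

Lemma is_derive_poly_eval (R : realType) (d : nat) (p : mpoly d.+1 R)
    (z a : 'rV[R]_d * R) :
  is_derive z a (poly_eval p)
    (\sum_(i < d.+1) xcoord a i * poly_eval (mderiv i p) z).
Proof.
move: p; apply: mpoly_ring_ind.
- move=> c; rewrite (_ : poly_eval _ = cst c); last first.
    by apply/funext => x; rewrite /poly_eval mevalC.
  apply: is_derive_eq; rewrite big1// => i _.
  by rewrite mderivC /poly_eval meval0 mulr0.
- move=> i.
  rewrite (_ : poly_eval _ = fun x => xcoord x i); last first.
    by apply/funext => x; rewrite /poly_eval mevalXU.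
  rewrite -[z]addr0 -(scale0r a) is_derive_line.
  rewrite (_ : (fun t => _) = cst (xcoord z i) + (xcoord a i \*: id)); last first.
    by apply/funext => t; rewrite xcoord_affine mulrC.
  apply: is_derive_eq; rewrite add0r (bigD1 i)//= big1 ?addr0 => [|j ji].
    rewrite mderivX mnm1E eqxx scale1r.
    rewrite (_ : mnm_sub _ _ = @mnm0 _); last by apply/mnmP => k; rewrite mnmBE mnm0E subnn.
    rewrite mpolyX0 /poly_eval meval1 mulr1.
    exact: mulr1.
  by rewrite mderivX mnm1E eq_sym (negbTE ji) /poly_eval mevalZ mul0r mulr0.
- move=> p q hp hq.
  rewrite (_ : poly_eval _ = poly_eval p + poly_eval q); last first.
    by apply/funext => x; rewrite /poly_eval mevalD.
  apply: is_derive_eq; rewrite -big_split/=; apply: eq_bigr => i _.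
  by rewrite mderivD {3}/poly_eval mevalD mulrDr.
- move=> p q hp hq.
  rewrite (_ : poly_eval _ = poly_eval p * poly_eval q); last first.
    by apply/funext => x; rewrite /poly_eval mevalM.
  apply: is_derive_eq; rewrite !scaler_sumr -big_split/=; apply: eq_bigr => i _.
  rewrite mderivM {5}/poly_eval mevalD !mevalM -!/(poly_eval _ _).
  by rewrite /GRing.scale/=; ring.
Qed.

Lemma xcoord_spt (R : realType) (d : nat) (s : d.+1.-tuple (measurableTypeR R)) i :
  xcoord (spt s) i =
  tnth s (if unlift ord_max i is Some j then lift ord0 j else ord0).
Proof.
rewrite /xcoord; case: unlift => [j|] //.
by rewrite mxE tnth_lift0.
Qed.

Lemma measurable_poly_eval (R : realType) (d : nat) (p : mpoly d.+1 R) :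
  measurable_fun setT (fun s : d.+1.-tuple (measurableTypeR R) => poly_eval p (spt s)).
Proof.
move: p; apply: mpoly_ring_ind.
- by move=> c; under eq_fun do rewrite /poly_eval mevalC; exact: measurable_cst.
- move=> i; under eq_fun do rewrite /poly_eval mevalXU -/(xcoord _ _) xcoord_spt.
  exact: measurable_tnth.
- move=> p q mp mq; under eq_fun do rewrite /poly_eval mevalD.
  exact: measurable_funD.
- move=> p q mp mq; under eq_fun do rewrite /poly_eval mevalM.
  exact: measurable_funM.
Qed.

(** Generalized for the induction on [n]: each variable of [p] is either already frozen to a
    constant ([inl]) or read from a remaining coordinate ([inr]). *)
Lemma slice_poly_meval (R : realType) (m r : nat) (p : mpoly m R) (pr : (msize p <= r.+1)%N) (n : nat)
    (w : 'I_m -> R + 'I_n) :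
  slice_poly r (fun s : n.-tuple (measurableTypeR R) =>
    meval (fun i => match w i with inl c => c | inr k => tnth s k end) p).
Proof.
elim: n w => [//|n IH] w; split.
  move=> s.
  pose v i : {poly R} := match w i with inl c => c%:P | inr k =>
    if unlift ord0 k is Some j then (tnth s j)%:P else 'X end.
  have [i|q sq qE] := @horner_meval _ _ _ p v pr.
    rewrite /v; case: (w i) => [c|k]; first by rewrite (leq_trans (size_polyC_leq1 _)).
    by case: unlift => [j|]; rewrite ?size_polyX// (leq_trans (size_polyC_leq1 _)).
  exists q => // x; rewrite qE; apply: meval_eq => i; rewrite /v.
  case: (w i) => [c|k]; first by rewrite hornerC.
  by case: (unliftP ord0 k) => [j ->|->]; rewrite ?tnthS ?tnth0 ?hornerC ?hornerX.
move=> x.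
pose w' i : R + 'I_n := match w i with inl c => inl c | inr k =>
    if unlift ord0 k is Some j then inr j else inl x end.
have := IH w'; congr slice_poly; apply/funext => s; apply: meval_eq => i.
rewrite /w'; case: (w i) => [//|k].
by case: (unliftP ord0 k) => [j ->|->]; rewrite ?tnthS ?tnth0.
Qed.

Lemma slice_poly_eval (R : realType) (d r : nat) (p : mpoly d.+1 R) :
  (msize p <= r.+1)%N ->
  slice_poly r (fun s : d.+1.-tuple (measurableTypeR R) => poly_eval p (spt s)).
Proof.
move=> pr; have := @slice_poly_meval R _ r p pr _
  (fun i => inr (if unlift ord_max i is Some j then lift ord0 j else ord0)).
congr slice_poly; apply/funext => s; apply: meval_eq => i.
by rewrite -xcoord_spt.
Qed.

(** * Geometry of a single element and the inverse estimate on it *)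

Lemma polytope_convex (R : realType) (d : nat) (K : set ('rV[R]_d * R)) :
  polytope K -> convexset K.
Proof.
move=> [m [p ->]] _ _ w [w1 [w10 w11 ->]] [w2 [w20 w21 ->]] /andP[w0 w1'].
exists (fun j => w * w1 j + (1 - w) * w2 j); split.
- by move=> j; rewrite addr_ge0// mulr_ge0// subr_ge0.
- by rewrite big_split/= -!mulr_sumr w11 w21 !mulr1 addrC subrK.
rewrite !scaler_sumr -big_split/=; apply: eq_bigr => j _.
by rewrite !scalerA -scalerDl.
Qed.

Lemma sum_xcoord_sqr (R : realType) (d : nat) (z : 'rV[R]_d * R) :
  \sum_(i < d.+1) xcoord z i ^+ 2 = \sum_(i < d) z.1 0 i ^+ 2 + z.2 ^+ 2.
Proof.
rewrite big_ord_recr /=; congr (_ + _); last by rewrite /xcoord unlift_none.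
apply: eq_bigr => i _; rewrite /xcoord.
have -> : widen_ord (leqnSn d) i = lift ord_max i.
  by apply/val_inj; rewrite /= /bump leqNgt ltn_ord.
by rewrite liftK.
Qed.

Lemma xcoord_le_enorm (R : realType) (d : nat) (z : 'rV[R]_d * R) i :
  `|xcoord z i| <= enorm z.
Proof.
rewrite /enorm -sum_xcoord_sqr -sqrtr_sqr ler_wsqrtr// (bigD1 i)//= lerDl.
by apply: sumr_ge0 => j _; exact: sqr_ge0.
Qed.

Lemma enorm_le (R : realType) (d : nat) (z : 'rV[R]_d * R) (a : R) : 0 <= a ->
  (forall i, `|xcoord z i| <= a) -> enorm z <= d.+1%:R * a.
Proof.
move=> a0 za; rewrite /enorm -sum_xcoord_sqr.
have d1 : 1 <= d.+1%:R :> R by rewrite ler1n.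
have h0 : 0 <= d.+1%:R * a by rewrite mulr_ge0.
rewrite -(ger0_norm h0) -sqrtr_sqr ler_wsqrtr//.
apply: (@le_trans _ _ (\sum_(i < d.+1) a ^+ 2)).
  apply: ler_sum => i _; rewrite -real_normK ?num_real//.
  by rewrite ler_pXn2r// nnegrE.
rewrite sumr_const card_ord -[leLHS]mulr_natl exprMn ler_wpM2r ?sqr_ge0//.
by rewrite expr2 ler_peMl// (le_trans ler01).
Qed.

Lemma xcoordB (R : realType) (d : nat) (z a : 'rV[R]_d * R) i :
  xcoord (z - a) i = xcoord z i - xcoord a i.
Proof. by rewrite -scaleN1r xcoord_affine mulN1r. Qed.

Lemma tnth_coords (R : realType) (d : nat) (z : 'rV[R]_d * R) i :
  tnth (coords z) (if unlift ord_max i is Some j then lift ord0 j else ord0) = xcoord z i.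
Proof. by rewrite -xcoord_spt coordsK. Qed.

Lemma tnth_xcoord (R : realType) (d : nat) (s : d.+1.-tuple (measurableTypeR R)) k :
  exists i, forall t : d.+1.-tuple (measurableTypeR R), tnth t k = xcoord (spt t) i.
Proof.
case: (unliftP ord0 k) => [j ->|->].
  by exists (lift ord_max j) => t; rewrite xcoord_spt liftK.
by exists ord_max => t; rewrite xcoord_spt unlift_none.
Qed.

(** The [sup] of a set without upper bound is 0 by convention, so a positive diameter forces the
    distances to be bounded. *)
Lemma le_diam (R : realType) (d : nat) (K : set ('rV[R]_d * R)) z1 z2 :
  0 < diam K -> K z1 -> K z2 -> enorm (z1 - z2) <= diam K.
Proof.
move=> d0 K1 K2; rewrite /diam.
apply: ub_le_sup; last by exists z1, z2.
apply: contrapT => nub; move: d0.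
by rewrite /diam sup_out ?ltxx// => -[].
Qed.

Lemma ball_xcoord (R : realType) (d : nat) (z w : 'rV[R]_d * R) (e : R) : 0 < e ->
  ball z e w <-> forall i, `|xcoord w i - xcoord z i| < e.
Proof.
move=> e0; split=> [[[_ b1] b2] i|b].
  rewrite /xcoord; case: unlift => [j|].
    by have := b1 ord0 j; rewrite /ball/= distrC.
  by rewrite distrC; exact: b2.
split.
  split=> // i j; rewrite (ord1 i) /ball/= distrC.
  by have := b (lift ord_max j); rewrite /xcoord liftK.
by rewrite /ball/= distrC; have := b ord_max; rewrite /xcoord unlift_none.
Qed.

Lemma box_ball (R : realType) (d : nat) (z : 'rV[R]_d * R) (e : R)
    (s : d.+1.-tuple (measurableTypeR R)) : 0 < e ->
  box (coords z) e s <-> ball z e (spt s).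
Proof.
move=> e0; rewrite ball_xcoord//; split=> b i.
  by rewrite xcoord_spt -tnth_coords; exact: b.
have [k kE] := tnth_xcoord s i; rewrite kE kE coordsK; exact: b.
Qed.


Definition unit_vector (R : realType) (d : nat) (k : 'I_d.+1) : 'rV[R]_d * R :=
  if unlift ord_max k is Some j then (delta_mx 0 j, 0) else (0, 1).

Lemma xcoord_unit_vector (R : realType) (d : nat) (k i : 'I_d.+1) :
  xcoord (@unit_vector R d k) i = (i == k)%:R.
Proof.
rewrite /unit_vector /xcoord; case: (unliftP ord_max k) => [j ->|->].
  case: (unliftP ord_max i) => [l ->|->] /=; last by rewrite eq_liftF.
  by rewrite mxE eqxx (inj_eq lift_inj).
case: (unliftP ord_max i) => [l ->|->] /=; last by rewrite eqxx.
by rewrite mxE eq_sym (negbTE (neq_lift _ _)).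
Qed.

Lemma deriv_poly_eval_line (R : realType) (d : nat) (p : mpoly d.+1 R) k z (q : {poly R}) :
  (forall t, poly_eval p (z + t *: unit_vector R k) = q.[t]) ->
  q^`().[0] = poly_eval (mderiv k p) z.
Proof.
move=> qE; have := is_derive_poly_eval p (z + 0 *: unit_vector R k) (unit_vector R k).
move=> /is_derive_line[_].
rewrite (_ : (fun t => _) = horner q); last by apply/funext => t; rewrite qE.
rewrite derive_val => ->; rewrite scale0r addr0 (bigD1 k)//= xcoord_unit_vector eqxx mul1r.
by rewrite big1 ?addr0// => i ik; rewrite xcoord_unit_vector (negbTE ik) mul0r.
Qed.

(** The integral of the square over the small cube bounds [q] on the large one, restriction to
    coordinate lines turns this into a bound on the partial derivative at every point of [K], and
    integrating it costs only the measure of [K]. All constants are fixed before [K]. *)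
Lemma inverse_estimate (R : realType) (d r : nat) (L : R) : 1 <= L ->
  exists2 C : R, 0 < C &
  forall (q : mpoly d.+1 R) (K : set ('rV[R]_d * R)) c (a : R) (k : 'I_d.+1),
    (msize q <= r.+1)%N -> 0 < a -> open K ->
    (forall s, box (coords c) a s -> K (spt s)) ->
    (forall z, K z -> forall i, `|xcoord z i - xcoord c i| <= L * a) ->
  ((a ^+ 2)%:E * \int[leb R d.+1]_(s in @spt R d @^-1` K) (poly_eval (mderiv k q) (spt s) ^+ 2)%:E
   <= C%:E * \int[leb R d.+1]_(s in @spt R d @^-1` K) (poly_eval q (spt s) ^+ 2)%:E)%E.
Proof.
move=> L1; have [M0 M00 HM0] := @sqr_le_integral_box R r d.+1 L L1.
have [M1 M10 HM1] := @poly_deriv_bound R r L L1.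
have L0 : 0 < L by apply: lt_le_trans L1.
have L20 : 0 < 2 * (L + 1) by rewrite mulr_gt0// addr_gt0.
(* The last factor is the measure of a cube containing [K], in units of a^(d+1). Its half side is
   [(L + 1) * a] because boxes are open while [K] only satisfies a non-strict bound by [L * a]. *)
pose C := M1 ^+ 2 * M0 * (2 * (L + 1)) ^+ d.+1.
have C0 : 0 < C by rewrite !mulr_gt0// exprn_gt0.
exists C => // q K c a k sq a0 oK bK KL.
have mK : measurable (@spt R d @^-1` K) by exact: open_measurable_spt.
have msq (p : mpoly d.+1 R) D : measurable_fun D (fun s : d.+1.-tuple (measurableTypeR R) => (poly_eval p (spt s) ^+ 2)%:E).
  apply/measurable_EFinP; apply: measurable_funTS; apply: measurable_funX.
  exact: measurable_poly_eval.
have sub : box (coords c) a `<=` @spt R d @^-1` K by move=> s; exact: bK.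
set J := (\int[leb R d.+1]_(s in box (coords c) a) (poly_eval q (spt s) ^+ 2)%:E)%E.
have JK : (J <= \int[leb R d.+1]_(s in @spt R d @^-1` K) (poly_eval q (spt s) ^+ 2)%:E)%E.
  apply: ge0_subset_integral => //; first exact: measurable_box.
  by move=> s _; rewrite lee_fin sqr_ge0.
apply: (@le_trans _ _ (C%:E * J)%E); last by rewrite lee_pmul2l// lte_fin.
have J0 : (0 <= J)%E by apply: integral_ge0 => s _; rewrite lee_fin sqr_ge0.
have val z : (forall i, `|xcoord z i - xcoord c i| <= L * a) ->
    ((poly_eval q z ^+ 2 * a ^+ d.+1)%:E <= M0%:E * J)%E.
  move=> zc; have := @HM0 (fun s => poly_eval q (spt s)) (coords c) (coords z) a.
  rewrite /= coordsK; apply => //.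
  - exact: measurable_poly_eval.
  - exact: slice_poly_eval.
  move=> i; have [l lE] := tnth_xcoord (coords z) i.
  by rewrite !lE !coordsK.
have KB : @spt R d @^-1` K `<=` box (coords c) ((L + 1) * a).
  move=> s Ks; apply/box_ball; first by rewrite mulr_gt0// addr_gt0.
  apply/ball_xcoord; first by rewrite mulr_gt0// addr_gt0.
  by move=> i; apply: le_lt_trans (KL _ Ks i) _; rewrite ltr_pM2r// ltrDl.
have LK : (leb R d.+1 (@spt R d @^-1` K) <= ((2 * ((L + 1) * a)) ^+ d.+1)%:E)%E.
  rewrite -(leb_box (coords c)); last by rewrite mulr_gt0// addr_gt0.
  by apply: le_measure; rewrite ?inE//; exact: measurable_box.
move: J0 val JK; case: J => [J'|_ _ _|//]; last first.
  by rewrite mulry gtr0_sg// mul1e leey.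
rewrite lee_fin => J0 val _.
have aD : 0 < a ^+ d.+1 by rewrite exprn_gt0.
pose m := Num.sqrt (M0 * J' / a ^+ d.+1).
have m2 : m ^+ 2 = M0 * J' / a ^+ d.+1.
  by rewrite sqr_sqrtr// divr_ge0 ?(ltW aD)// mulr_ge0// ltW.
have pt z : K z -> a ^+ 2 * poly_eval (mderiv k q) z ^+ 2 <= M1 ^+ 2 * m ^+ 2.
  move=> Kz; have [Q sQ QE] := @poly_eval_line R d r q z (unit_vector R k) sq.
  have dQ := deriv_poly_eval_line QE.
  (* On the line through [z] in direction [k], the parameter 0 is [z] itself, and the centre is the
     parameter at which the coordinate [k] equals that of [c]. *)
  have := HM1 Q a (xcoord c k - xcoord z k) 0 m sQ a0 (sqrtr_ge0 _).
  rewrite dQ => H; rewrite -!exprMn.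
  rewrite -[leLHS]real_normK ?num_real// ler_pXn2r// ?nnegrE ?mulr_ge0 ?sqrtr_ge0 ?(ltW M10)//.
  rewrite normrM (gtr0_norm a0); apply: H; last first.
    by rewrite sub0r opprB; exact: KL.
  move=> t tc; rewrite -QE -sqrtr_sqr ler_wsqrtr// ler_pdivlMr//.
  rewrite -lee_fin EFinM; apply: val => i.
  rewrite xcoord_affine xcoord_unit_vector; case: eqP => [->|_].
    rewrite mulr1 (le_trans _ (ler_peMl (ltW a0) L1))//.
    by rewrite (le_trans _ tc)// opprB addrA [t + _]addrC.
  by rewrite mulr0 addr0; exact: KL.
rewrite -ge0_integralZl//; last 2 first.
- by move=> s _; rewrite lee_fin sqr_ge0.
- by rewrite lee_fin sqr_ge0.
apply: (@le_trans _ _ (\int[leb R d.+1]_(s in @spt R d @^-1` K) (M1 ^+ 2 * m ^+ 2)%:E)%E).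
  apply: ge0_le_integral => //.
  - by move=> s _; rewrite -EFinM lee_fin mulr_ge0// sqr_ge0.
  - by apply: measurable_funeM; exact: msq.
  - by move=> s Ks; rewrite -EFinM lee_fin; exact: pt.
rewrite integral_cst// (le_trans (lee_wpmul2l _ LK))//.
  by rewrite lee_fin mulr_ge0// sqr_ge0.
rewrite -!EFinM lee_fin m2 /C !exprMn.
rewrite le_eqVlt; apply/orP; left; apply/eqP; field.
by rewrite expf_neq0// gt_eqF.
Qed.

(** * Elementwise polynomials on a tessellation *)

Section mesh.
Context (R : realType) (d : nat) (Os : set 'rV[R]_d) (T : R).
Context (Os_open : open Os) (Os_bounded : bounded_set Os) (T_gt0 : 0 < T).
Local Notation Om := (cylinder Os T).

Lemma open_cylinder : open Om.
Proof.
rewrite (_ : Om = (fst @^-1` Os) `&` (snd @^-1` `]0, T[%classic)); last first.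
  by apply/seteqP; split.
apply: openI; apply: open_comp => //.
- by move=> z _; exact: cvg_fst.
- by move=> z _; exact: cvg_snd.
Qed.

Lemma itvoo_dense (u e : R) : 0 <= u <= T -> 0 < e ->
  exists2 t, 0 < t < T & `|u - t| < e.
Proof.
move=> /andP[u0 uT] e0.
(* The point [u] is moved towards the midpoint [T / 2] by the fraction [l], which displaces it by at
   most [l * T < e]. *)
pose l := e / (e + T).
have eT : 0 < e + T by rewrite addr_gt0.
have l0 : 0 < l by rewrite divr_gt0.
have l1 : l < 1 by rewrite ltr_pdivrMr// mul1r ltrDl.
have lT : l * T < e.
  by rewrite /l mulrAC ltr_pdivrMr//; have := T_gt0; nra.
have h1 : 0 <= l * u by rewrite mulr_ge0// ltW.
have h2 : l * u <= l * T by rewrite ler_pM2l.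
have h3 : 0 < l * T by rewrite mulr_gt0.
have h4 : 0 <= (1 - l) * (T - u) by rewrite mulr_ge0 ?subr_ge0// ltW.
have h5 : 0 <= (1 - l) * u by rewrite mulr_ge0 ?subr_ge0// ltW.
rewrite mulrBl mul1r in h5; rewrite mulrBl mul1r mulrBr in h4.
exists ((1 - l) * u + l * (T / 2)); rewrite mulrBl mul1r mulrA.
  by apply/andP; split; lra.
by rewrite ltr_norml; apply/andP; split; lra.
Qed.

Lemma closure_cylinder z : closure Om z <-> closure Os z.1 /\ 0 <= z.2 <= T.
Proof.
split=> [cz|[cz /andP[z0 zT]] W /nbhs_ballP[e /= e0 We]].
  split.
    move=> U Uz; have [|[x t] [[Ox _] Ux]] := cz (fst @^-1` U); last by exists x.
    by apply: (@cvg_fst _ _ _ _ _ U).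
  have cl : closed (snd @^-1` `[0, T]%classic : set ('rV[R]_d * R)).
    apply: preimage_closed; [move=> x _; exact: cvg_snd|exact: interval_closed].
  have : (snd @^-1` `[0, T]%classic : set ('rV[R]_d * R)) z.
    apply: cl; apply: (closureS _ cz) => -[x t] [_] /=.
    by rewrite /preimage/= !in_itv/= => /andP[h1 h2]; rewrite !ltW.
  by rewrite /preimage/= in_itv.
have [x [Ox bx]] := cz _ (nbhsx_ballx z.1 e e0).
have [t t0T tz] := itvoo_dense (introT andP (conj z0 zT)) e0.
by exists (x, t); split; [split=> //=; rewrite in_itv|exact: We].
Qed.

Lemma cylinder_box : exists2 M : R, 0 < M &
  @spt R d @^-1` closure Om `<=` box (coords 0) M.
Proof.
have [M [_ MO]] := Os_bounded.
pose B := Num.max (M + 1) (T + 1).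
have B0 : 0 < B + 1.
  by rewrite ltr_wpDl// /B le_max [X in _ || X]addr_ge0 ?orbT// ltW.
exists (B + 1) => // s /= /closure_cylinder[cz /andP[z0 zT]].
apply/(@box_ball _ _ 0) => //; rewrite -ball_normE/= sub0r normrN.
rewrite prod_normE gt_max; apply/andP; split; last first.
  rewrite ger0_norm// (le_lt_trans zT)// (@lt_le_trans _ _ (T + 1)) ?ltrDl//.
  by rewrite (@le_trans _ _ B) ?lerDl// le_max lexx orbT.
have cl : closed [set x : 'rV[R]_d | `|x| <= M + 1].
  apply: (@preimage_closed _ _ (fun x : 'rV[R]_d => `|x|) [set x | x <= M + 1]).
    by move=> x _; exact: norm_continuous.
  exact: closed_le.
have : [set x : 'rV[R]_d | `|x| <= M + 1] (spt s).1.
  by apply: cl; apply: (closureS _ cz) => x Ox; apply: MO; rewrite ?ltrDl.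
move=> /le_lt_trans; apply; rewrite (@le_lt_trans _ _ B) ?ltrDl//.
by rewrite le_max lexx.
Qed.

Context (N : nat) (Th : 'I_N -> set ('rV[R]_d * R)%type).
Context (tess : tessellation Os T Th).
Definition elems : set ('rV[R]_d * R) := \bigcup_j (Th j)°.

Lemma elems_cylinder : elems `<=` Om.
Proof. by case: tess => _ _ sub _ z [j _ /sub]. Qed.

Lemma open_elems : open elems.
Proof. by apply: bigcup_open => j _; exact: open_interior. Qed.

Lemma Th_cylinder j z : Th j z -> closure Om z.
Proof. by case: tess => _ _ _ -> Tz; exists j. Qed.

Lemma Th_convex j : convexset (Th j).
Proof. by apply: polytope_convex; case: tess => /(_ j)[]. Qed.

(** A point of the closed cylinder belongs to some element; if it is interior to none, it lies on
    the boundary of that element. There are finitely many such boundaries, all null by convexity. *)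
Lemma skeleton_null : leb R d.+1 (@spt R d @^-1` (closure Om `\` elems)) = 0%E.
Proof.
have [M M0 bM] := cylinder_box.
have mS : measurable (@spt R d @^-1` (closure Om `\` elems)).
  apply: closed_measurable_spt; rewrite setDE; apply: closedI.
    exact: closed_closure.
  by apply: open_closedC; exact: open_elems.
apply/(negligibleP _ mS).
(* Countable unions are indexed by [nat]; indices from [N] on carry the empty set. *)
pose F (k : nat) : set (d.+1.-tuple (measurableTypeR R)) :=
  if insub k is Some j then @spt R d @^-1` (closure (Th j) `\` (Th j)°) else set0.
apply: (@negligibleS _ _ _ _ (\bigcup_k F k)).
  move=> s /= [cs nel]; move: cs; case: tess => _ _ _ -> [j _ Tj].
  exists (val j) => //; rewrite /F; case: insubP => [u _ /val_inj->|]; last by rewrite ltn_ord.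
  by split; [exact: subset_closure|move=> Tjs; apply: nel; exists j].
apply: negligible_bigcup => k; rewrite /F; case: insub => [j|]; last exact: negligible_set0.
apply/negligibleP.
  apply: closed_measurable_spt; rewrite setDE; apply: closedI.
    exact: closed_closure.
  by apply: open_closedC; exact: open_interior.
apply: (@convex_boundary_null R d (Th j) (coords 0) M).
- exact: Th_convex.
- by case: tess => /(_ j)[].
move=> s cs; apply: bM.
have : closure (closure Om) (spt s) by apply: closureS cs => z; exact: Th_cylinder.
by rewrite -(closure_id _).1//; exact: closed_closure.
Qed.

(** Only the interiors of elements are concerned, so the property passes to [hdx] and [hdt] and can
    be iterated up to the Laplacian. *)
Definition elementwise (f : 'rV[R]_d * R -> R) (p : 'I_N -> mpoly d.+1 R) : Prop :=
  forall j z, (Th j)° z -> f z = poly_eval (p j) z.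

Lemma near_elementwise f p j z : elementwise f p -> (Th j)° z ->
  \forall w \near z, f w = poly_eval (p j) w.
Proof.
move=> fp Tz; have : nbhs z (Th j)°.
  by apply: open_nbhs_nbhs; split=> //; exact: open_interior.
by apply: filterS => w; exact: fp.
Qed.

Lemma is_derive_elementwise f p j z a : elementwise f p -> (Th j)° z ->
  is_derive z a f (\sum_(i < d.+1) xcoord a i * poly_eval (mderiv i (p j)) z).
Proof.
move=> fp Tz; have := near_elementwise fp Tz.
have := is_derive_poly_eval (p j) z a.
move=> [h1 h2] nf; split.
  by apply: (near_eq_derivable _ h1); apply: filterS nf => w ->.
by rewrite -h2; exact: near_eq_derive.
Qed.

Lemma hderiveE f p j z a : elementwise f p -> (Th j)° z ->
  hderive Th a f z = \sum_(i < d.+1) xcoord a i * poly_eval (mderiv i (p j)) z.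
Proof.
move=> fp Tz; rewrite /hderive mem_set; last by exists j.
by have [_] := is_derive_elementwise a fp Tz.
Qed.

Lemma hderive_skeleton f a z : ~ elems z -> hderive Th a f z = 0.
Proof. by move=> nz; rewrite /hderive memNset. Qed.

Lemma elementwise_hdx f p i : elementwise f p ->
  elementwise (hdx Th i f) (fun j => mderiv (lift ord_max i) (p j)).
Proof.
move=> fp j z Tz; rewrite /hdx (hderiveE _ fp Tz) (bigD1 (lift ord_max i))//=.
rewrite /xcoord liftK /= mxE !eqxx mul1r big1 ?addr0// => k ki.
case: (unliftP ord_max k) ki => [l ->|-> _]; last by rewrite mul0r.
by rewrite /= mxE eqxx (inj_eq lift_inj) => /negbTE ->; rewrite mul0r.
Qed.

Lemma elementwise_hdt f p : elementwise f p ->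
  elementwise (hdt Th f) (fun j => mderiv ord_max (p j)).
Proof.
move=> fp j z Tz; rewrite /hdt (hderiveE _ fp Tz) (bigD1 ord_max)//=.
rewrite /xcoord unlift_none /= mul1r big1 ?addr0// => k ki.
case: (unliftP ord_max k) ki => [l ->|->]; last by rewrite eqxx.
by rewrite /= mxE mul0r.
Qed.

Lemma cylinder_measurable : measurable (@spt R d @^-1` Om).
Proof. by apply: open_measurable_spt; exact: open_cylinder. Qed.

Lemma space_measurable : measurable (@vec R d @^-1` Os).
Proof. exact: open_measurable_vec. Qed.

(* Only the values on the open cylinder matter; [f] need not be measurable
   elsewhere. *)
Definition bmeas (f : 'rV[R]_d * R -> R) : Prop :=
  measurable_fun setT (fun s : d.+1.-tuple (measurableTypeR R) => (f \_ Om) (spt s)) /\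
  exists C, forall z, `|(f \_ Om) z| <= C.

Lemma bmeasD f g : bmeas f -> bmeas g -> bmeas (fun z => f z + g z).
Proof.
have E z : ((fun z => f z + g z) \_ Om) z = (f \_ Om) z + (g \_ Om) z.
  by rewrite !patchE; case: ifP => // _; rewrite addr0.
move=> [mf [C fC]] [mg [D gD]]; split; first by under eq_fun do rewrite E; exact: measurable_funD.
exists (C + D) => z; rewrite E; apply: le_trans (ler_normD _ _) _; exact: lerD.
Qed.

Lemma bmeasM f g : bmeas f -> bmeas g -> bmeas (fun z => f z * g z).
Proof.
have E z : ((fun z => f z * g z) \_ Om) z = (f \_ Om) z * (g \_ Om) z.
  by rewrite !patchE; case: ifP => // _; rewrite mulr0.
move=> [mf [C fC]] [mg [D gD]]; split; first by under eq_fun do rewrite E; exact: measurable_funM.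
by exists (C * D) => z; rewrite E normrM ler_pM.
Qed.

Lemma bmeas_cst c : bmeas (fun=> c).
Proof.
split.
  rewrite (_ : (fun s => _) = (cst c) \_ (@spt R d @^-1` Om)).
    apply/(measurable_restrictT _ _).1; last exact: measurable_funTS.
    exact: cylinder_measurable.
  by apply/funext => s; rewrite !patchE.
exists `|c| => z; rewrite patchE; case: ifP => //; by rewrite normr0.
Qed.

Lemma bmeasZ c f : bmeas f -> bmeas (fun z => c * f z).
Proof. by move=> bf; apply: bmeasM => //; exact: bmeas_cst. Qed.

Lemma bmeas_sum (n : nat) (f : 'I_n -> 'rV[R]_d * R -> R) :
  (forall i, bmeas (f i)) -> bmeas (fun z => \sum_(i < n) f i z).
Proof.
elim: n f => [|n IH] f bf.
  by under eq_fun do rewrite big_ord0; exact: bmeas_cst.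
by under eq_fun do rewrite big_ord_recl; apply: bmeasD => //; exact: IH.
Qed.

Lemma cylinder_finite : (leb R d.+1 (@spt R d @^-1` Om) < +oo)%E.
Proof.
have [M M0 bM] := cylinder_box.
apply: (@le_lt_trans _ _ (leb R d.+1 (box (coords 0) M))).
  apply: le_measure; rewrite ?inE; [exact: cylinder_measurable|exact: measurable_box|].
  by move=> s /subset_closure/bM.
by rewrite leb_box// ltry.
Qed.

Lemma bmeas_integrable f : bmeas f ->
  (leb R d.+1).-integrable setT (fun s => ((f \_ Om) (spt s))%:E).
Proof.
move=> [mf [C fC]].
have mO := cylinder_measurable.
rewrite (_ : (fun s => _) = (fun s => ((f \_ Om) (spt s))%:E) \_ (@spt R d @^-1` Om)); last first.
  apply/funext => s; rewrite [RHS]patchE; case: ifPn => //.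
  by rewrite notin_setE /preimage /= => nO; rewrite patchE memNset.
apply/(integrable_mkcond _ mO).1.
apply: measurable_bounded_integrable => //.
- exact: cylinder_finite.
- exact: measurable_funTS.
- by exists C; split; [exact: num_real|move=> x xC s _ /=; rewrite (le_trans (fC _))// ltW].
Qed.

(** * Integrals over time slices and over the cylinder *)

Definition slice_int (f : 'rV[R]_d * R -> R) (t : R) : R :=
  \int[leb R d]_(s in @vec R d @^-1` Os) f (vec s, t).

(** The forms [B] and [Bh] and the energy norm are written with iterated integrals; as single
    integrals over space-time they can be compared pointwise, sheared, and split over elements. *)
Definition cyl_int (f : 'rV[R]_d * R -> R) : R :=
  \int[leb R d.+1]_s (f \_ Om) (spt s).

Lemma slice_intE f t : 0 < t < T ->
  slice_int f t = \int[leb R d]_s (f \_ Om) (vec s, t).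
Proof.
move=> t0T; rewrite /slice_int Rintegral_mkcond; apply: eq_Rintegral => s _.
rewrite !patchE; congr (if _ then _ else _).
apply/idP/idP; rewrite !inE; last by case.
by move=> h; split=> //=; rewrite in_itv.
Qed.

Lemma cyl_notin (f : 'rV[R]_d * R -> R) (t : R) x : ~ (0 < t < T) -> (f \_ Om) (x, t) = 0.
Proof. by move=> nt; rewrite patchE memNset// => -[_]; rewrite /= in_itv. Qed.

Lemma space_box : exists2 M : R, 0 < M &
  @vec R d @^-1` Os `<=` box [tuple of behead (coords (0 : 'rV[R]_d * R))] M.
Proof.
have [M M0 bM] := cylinder_box; exists M => // s Os_s.
have : (@spt R d @^-1` closure Om) (cons_pair (T / 2, s)).
  apply: subset_closure; rewrite spt_cons; split => //=.
  by rewrite in_itv/=; apply/andP; split; have := T_gt0; lra.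
by move=> /bM /box_cons[].
Qed.

Lemma space_finite : (leb R d (@vec R d @^-1` Os) < +oo)%E.
Proof.
have [M M0 bM] := space_box.
apply: (@le_lt_trans _ _ (leb R d (box [tuple of behead (coords (0 : 'rV[R]_d * R))] M))).
  by apply: le_measure; rewrite ?inE; [exact: space_measurable|exact: measurable_box|].
by rewrite leb_box// ltry.
Qed.

Lemma bmeas_slice f t : bmeas f ->
  (leb R d).-integrable setT (fun s => ((f \_ Om) (vec s, t))%:E).
Proof.
move=> [mf [C fC]].
have mO := space_measurable.
rewrite (_ : (fun s => _) = (fun s => ((f \_ Om) (vec s, t))%:E) \_ (@vec R d @^-1` Os)); last first.
  apply/funext => s; rewrite [RHS]patchE; case: ifPn => //.
  by rewrite notin_setE /preimage /= => nO; rewrite patchE memNset// => -[].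
apply/(integrable_mkcond _ mO).1.
apply: measurable_bounded_integrable => //.
- exact: space_finite.
- apply: measurable_funTS.
  rewrite (_ : (fun s => _) = (fun s => (f \_ Om) (spt s)) \o (fun s => cons_pair (t, s))).
    by apply: measurableT_comp => //; exact: measurable_cons_r.
  by apply/funext => s /=; rewrite spt_cons.
- by exists C; split; [exact: num_real|move=> x xC s _ /=; rewrite (le_trans (fC _))// ltW].
Qed.

Lemma slice_intD f g t : 0 < t < T -> bmeas f -> bmeas g ->
  slice_int (fun z => f z + g z) t = slice_int f t + slice_int g t.
Proof.
move=> t0T bf bg; rewrite !slice_intE// -RintegralD//; try exact: bmeas_slice.
by apply: eq_Rintegral => s _; rewrite !patchE; case: ifP => // _; rewrite addr0.
Qed.

Lemma slice_intZ f c t : 0 < t < T -> bmeas f ->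
  slice_int (fun z => c * f z) t = c * slice_int f t.
Proof.
move=> t0T bf; rewrite !slice_intE// -RintegralZl//; try exact: bmeas_slice.
by apply: eq_Rintegral => s _; rewrite !patchE; case: ifP => // _; rewrite mulr0.
Qed.

Lemma slice_int_sum (n : nat) (f : 'I_n -> 'rV[R]_d * R -> R) t : 0 < t < T ->
  (forall i, bmeas (f i)) ->
  slice_int (fun z => \sum_(i < n) f i z) t = \sum_(i < n) slice_int (f i) t.
Proof.
move=> t0T; elim: n f => [|n IH] f bf.
  rewrite big_ord0 /slice_int; under eq_Rintegral do rewrite big_ord0.
  by rewrite Rintegral_cst ?mul0r//; exact: space_measurable.
rewrite big_ord_recl -IH// -slice_intD//; last exact: bmeas_sum.
by congr (slice_int _ t); apply/funext => z; rewrite big_ord_recl.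
Qed.

Lemma cyl_intD f g : bmeas f -> bmeas g ->
  cyl_int (fun z => f z + g z) = cyl_int f + cyl_int g.
Proof.
move=> bf bg; rewrite /cyl_int -RintegralD//; try exact: bmeas_integrable.
by apply: eq_Rintegral => s _; rewrite !patchE; case: ifP => // _; rewrite addr0.
Qed.

Lemma cyl_intZ f c : bmeas f -> cyl_int (fun z => c * f z) = c * cyl_int f.
Proof.
move=> bf; rewrite /cyl_int -RintegralZl//; try exact: bmeas_integrable.
by apply: eq_Rintegral => s _; rewrite !patchE; case: ifP => // _; rewrite mulr0.
Qed.

Lemma le_cyl_int f g : bmeas f -> bmeas g -> (forall z, Om z -> f z <= g z) ->
  cyl_int f <= cyl_int g.
Proof.
move=> bf bg fg; apply: le_Rintegral => //; try exact: bmeas_integrable.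
by move=> s _; rewrite !patchE; case: ifPn => //; rewrite inE => /fg.
Qed.

Lemma cyl_int_ge0 f : (forall z, Om z -> 0 <= f z) -> 0 <= cyl_int f.
Proof.
move=> f0; apply: Rintegral_ge0 => s _; rewrite patchE; case: ifPn => //.
by rewrite inE => /f0.
Qed.

Lemma integrable_cons_pair (f : d.+1.-tuple (measurableTypeR R) -> \bar R) :
  (leb R d.+1).-integrable setT f ->
  (product_measure1 (@lebesgue_measure R) (leb R d)).-integrable setT (f \o @cons_pair R d).
Proof.
move=> /integrableP[mf fi]; have mc := @measurable_cons_pair R d.
apply/integrableP; split; first exact: measurableT_comp.
rewrite -(preimage_setT (@cons_pair R d)).
have := @ge0_integral_pushforward _ _ _ _ _ _ mc
  (product_measure1 (@lebesgue_measure R) (leb R d)) setT (fun s => `|f s|%E) measurableT.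
move=> /(_ _ _)<-//.
exact: measurableT_comp.
Qed.

Lemma integral_cons_pair (f : d.+1.-tuple (measurableTypeR R) -> \bar R) :
  (leb R d.+1).-integrable setT f ->
  (\int[leb R d.+1]_s f s =
   \int[@lebesgue_measure R]_t \int[leb R d]_s f (cons_pair (t, s)))%E.
Proof.
move=> intf; have mf := measurable_int _ intf.
have intf' := integrable_cons_pair intf.
have -> := @integral_pushforward _ _ _ _ _ _ (@measurable_cons_pair R d)
  (product_measure1 (@lebesgue_measure R) (leb R d)) setT f mf intf' measurableT.
rewrite preimage_setT.
exact: (esym (integral12_prod_meas1 intf')).
Qed.

Lemma cyl_intE f : bmeas f ->
  cyl_int f = fine (\int[@lebesgue_measure R]_t \int[leb R d]_s ((f \_ Om) (vec s, t))%:E)%E.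
Proof.
move=> /bmeas_integrable/integral_cons_pair; rewrite /cyl_int /Rintegral => ->.
congr fine; apply: eq_integral => t _.
by apply: eq_integral => s _ /=; rewrite spt_cons.
Qed.

Lemma time_int_slice f : bmeas f -> time_int T (slice_int f) = cyl_int f.
Proof.
move=> bf; rewrite cyl_intE// /time_int /Rintegral; congr fine.
rewrite integral_mkcond; apply: eq_integral => t _; rewrite patchE.
case: ifPn; rewrite ?notin_setE ?inE /= in_itv/= => t0T.
  rewrite slice_intE// fineK//; apply: integrable_fin_num => //.
  exact: bmeas_slice.
by rewrite integral0_eq// => s _; rewrite cyl_notin.
Qed.

Lemma poly_eval_bounded (p : mpoly d.+1 R) :
  exists C, forall z, closure Om z -> `|poly_eval p z| <= C.
Proof.
have [M M0 bM] := cylinder_box.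
have zM z i : closure Om z -> `|xcoord z i| <= M.
  move=> Oz; have : (@spt R d @^-1` closure Om) (coords z) by rewrite /preimage/= coordsK.
  move=> /bM /(box_ball _ _ M0); rewrite coordsK (ball_xcoord _ _ M0) => /(_ i) /ltW.
  by rewrite [X in _ - X](_ : _ = 0) ?subr0// /xcoord; case: unlift => //= j; rewrite mxE.
move: p; apply: mpoly_ring_ind.
- by move=> c; exists `|c| => z _; rewrite /poly_eval mevalC.
- move=> i; exists M => z Oz; rewrite /poly_eval mevalXU.
  exact: zM.
- move=> p q [C pC] [D qD]; exists (C + D) => z Oz; rewrite /poly_eval mevalD.
  by apply: le_trans (ler_normD _ _) _; apply: lerD; [exact: pC|exact: qD].
- move=> p q [C pC] [D qD]; exists (C * D) => z Oz; rewrite /poly_eval mevalM normrM.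
  by apply: ler_pM => //; [exact: pC|exact: qD].
Qed.

Lemma elem_inj i j z : (Th i)° z -> (Th j)° z -> i = j.
Proof.
move=> iz jz; apply: contrapT => /eqP ij.
case: tess => _ /(_ i j ij) E _ _.
by have : set0 z by rewrite -E.
Qed.

(** The value 0 off the open elements makes [f] a finite sum of polynomials cut off to open sets.
    The default value in [hderive] provides it. *)
Lemma bmeas_elementwise f p : elementwise f p -> (forall z, ~ elems z -> f z = 0) ->
  bmeas f.
Proof.
move=> fp f0; split.
  rewrite (_ : (fun s => _) = (fun s => \sum_(j < N)
     ((fun s => poly_eval (p j) (spt s)) \_ (@spt R d @^-1` (Th j)°)) s)).
    apply: measurable_sum => j.
    apply/(measurable_restrictT _ _).1.
      by apply: open_measurable_spt; exact: open_interior.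
    by apply: measurable_funTS; exact: measurable_poly_eval.
  apply/funext => s; rewrite patchE.
  have [[j _ Tj]|nz] := pselect (elems (spt s)).
    rewrite mem_set; last by apply: elems_cylinder; exists j.
    rewrite (bigD1 j)//= patchE mem_set// (fp j)// big1 ?addr0// => i ij.
    rewrite patchE memNset// => Ti; move/eqP: ij; apply; exact: elem_inj Ti Tj.
  rewrite f0// if_same big1// => j _; rewrite patchE memNset// => Tj; apply: nz; exists j => //.
have [C pC] := choice (fun j => poly_eval_bounded (p j)).
exists (\sum_(j < N) `|C j|) => z; rewrite patchE.
have S0 : 0 <= \sum_(j < N) `|C j| by apply: sumr_ge0.
case: ifPn; rewrite ?inE ?normr0// => Oz.
have [[j _ Tj]|nz] := pselect (elems z); last by rewrite f0// normr0.
rewrite (fp j)// (bigD1 j)//= (le_trans (pC _ _ (subset_closure Oz)))// (le_trans (ler_norm _))// lerDl.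
exact: sumr_ge0.
Qed.

Lemma within_continuous_near (v : 'rV[R]_d * R -> R) (z : 'rV[R]_d * R) (e : R) :
  {within closure Om, continuous v} -> closure Om z -> 0 < e ->
  \forall w \near z, closure Om w -> `|v z - v w| < e.
Proof.
move=> cv cz e0.
by move/subspace_continuousP : cv => /(_ z cz) /(_ _ (nbhsx_ballx _ _ e0)).
Qed.

(** Since [v] need not vanish on the skeleton, measurability comes from continuity: its strict
    superlevel sets in the open cylinder are open. Boundedness comes from the polynomials on the
    closed elements, which cover. *)
Lemma bmeas_Vh r v : Vh r Os T Th v -> bmeas v.
Proof.
move=> [cv pv _ _]; split.
  rewrite (_ : (fun s => _) = (v \o @spt R d) \_ (@spt R d @^-1` Om)); last first.
    by apply/funext => s; rewrite !patchE.
  apply/(measurable_restrictT _ _).1; first exact: cylinder_measurable.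
  apply: (measurability _ (RGenOInfty.measurableE R)) => _ [_ [a ->]] <-.
  rewrite preimage_itvoy.
  rewrite [X in measurable X](_ : _ = @spt R d @^-1` [set z | Om z /\ a < v z]); last by [].
  apply: open_measurable_spt; rewrite openE => z [Oz az].
  have e0 : 0 < v z - a by rewrite subr_gt0.
  have n1 := within_continuous_near cv (subset_closure Oz) e0.
  have n2 : \forall w \near z, Om w.
    by apply: open_nbhs_nbhs; split=> //; exact: open_cylinder.
  near=> w; have Ow : Om w by near: w.
  split=> //.
  have : `|v z - v w| < v z - a by move: (subset_closure Ow); near: w.
  by rewrite ltr_norml => /andP[_]; rewrite ltrD2l ltrN2.
have /choice[p pP] : forall j, exists q : mpoly d.+1 R, forall z, Th j z -> v z = poly_eval q z.
  by move=> j; have [q _ qv] := pv j; exists q.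
have [C pC] := choice (fun j => poly_eval_bounded (p j)).
exists (\sum_(j < N) `|C j|) => z; rewrite patchE.
have S0 : 0 <= \sum_(j < N) `|C j| by apply: sumr_ge0.
case: ifPn; rewrite ?inE ?normr0// => Oz.
have : closure Om z by exact: subset_closure.
case: tess => _ _ _ -> [j _ Tj].
rewrite (pP j)// (bigD1 j)//= (le_trans (pC _ _ (subset_closure Oz)))// (le_trans (ler_norm _))// lerDl.
exact: sumr_ge0.
Unshelve. all: by end_near.
Qed.

(** The lateral condition is assumed for 0 < t < T; continuity extends it to the times 0 and [T]. *)
Lemma Vh_boundary r v z : Vh r Os T Th v -> closure Om z -> ~ Os z.1 -> v z = 0.
Proof.
move=> [cv _ v0 _] cz nO; apply: contrapT => /eqP vz.
have e0 : 0 < `|v z| by rewrite normr_gt0.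
have [cz1 z2] := (closure_cylinder z).1 cz.
have /nbhs_ballP[e /= e1 He] := within_continuous_near cv cz e0.
have [t t0T tz] := itvoo_dense z2 e1.
have bz : ball z e (z.1, t) by split=> //=; exact: ballxx.
have ct : closure Om (z.1, t).
  by apply/closure_cylinder; split=> //=; case/andP: t0T => h1 h2; rewrite !ltW.
by have := He _ bz ct; rewrite v0// subr0 ltxx.
Qed.

(** * The energy identity *)

Definition line (y b : 'rV[R]_d) (t : R) : 'rV[R]_d * R := (y, 0) + t *: (b, 1).

Lemma lineE y b t : line y b t = (y + t *: b, t).
Proof. by rewrite /line; congr pair; rewrite /= add0r [LHS]mulr1. Qed.

Lemma continuous_line y b : continuous (line y b).
Proof.
move=> t; apply: cvgD; first exact: cvg_cst.
by apply: cvgZr_tmp; exact: cvg_id.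
Qed.

(** Above the boundary of the domain, [v] vanishes and matches the extension by 0. The restriction
    to [0, T] matters: the extension may jump after the final time, where [v] is not prescribed. *)
Lemma continuous_vext_line r v y b : Vh r Os T Th v ->
  {within `[0, T], continuous (fun t => (v \_ (closure Om)) (line y b t))}.
Proof.
move=> Vv; have [cv _ _ _] := Vv.
apply/subspace_continuousP => t0 t0T.
apply/cvgrPdist_lt => e e0; rewrite near_withinE.
suff H : \forall t \near t0, `[0, T]%classic t ->
    `|(v \_ (closure Om)) (line y b t0) - (v \_ (closure Om)) (line y b t)| < e by exact: H.
have cl := @continuous_line y b t0.
have [cz|ncz] := pselect (closure Om (line y b t0)); last first.
  rewrite patchE memNset//.
  have : \forall t \near t0, ~ closure Om (line y b t).
    apply: (cl (~` closure Om)); apply: open_nbhs_nbhs; split=> //.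
    by apply: closed_openC; exact: closed_closure.
  by apply: filterS => t nt _; rewrite patchE memNset// subrr normr0.
rewrite patchE mem_set//.
have n1 : \forall t \near t0, closure Om (line y b t) -> `|v (line y b t0) - v (line y b t)| < e.
  exact: (cl _ (within_continuous_near cv cz e0)).
have [Oz|nOz] := pselect (Os (line y b t0).1).
  have n2 : \forall t \near t0, Os (line y b t).1.
    apply: (cl (fst @^-1` Os)); apply: (@cvg_fst _ _ _ _ _ Os).
    by apply: open_nbhs_nbhs.
  near=> t => tT.
  have ct : closure Om (line y b t).
    apply/closure_cylinder; split; first by apply: subset_closure; near: t.
    by rewrite lineE /=; move: tT; rewrite /= in_itv.
  by rewrite patchE mem_set//; move: ct; near: t.
rewrite (Vh_boundary Vv cz nOz).
near=> t => tT; rewrite patchE; case: ifPn => [|_]; last by rewrite subrr normr0.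
rewrite inE => ct; rewrite -(Vh_boundary Vv cz nOz).
by move: ct; near: t.
Unshelve. all: by end_near.
Qed.

(* [sup] and [inf] of the empty set are junk values, which merely add
   breakpoints. *)
Definition breakpoints y b : seq R :=
  [seq sup [set t | Th j (line y b t)] | j <- enum 'I_N] ++
  [seq inf [set t | Th j (line y b t)] | j <- enum 'I_N].

Lemma line_convex y b t1 t2 (w : R) :
  line y b (w * t1 + (1 - w) * t2) = w *: line y b t1 + (1 - w) *: line y b t2.
Proof.
rewrite !lineE; congr pair => /=.
by rewrite !scalerDr !scalerA addrACA -!scalerDl addrCA subrr addr0 scale1r.
Qed.

(** By convexity the times spent in an element form an interval whose ends are breakpoints, so an
    open interval without breakpoints lies entirely inside it or entirely outside. *)
Lemma Th_line_itv y b j c d' t1 t2 :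
  (forall e, e \in breakpoints y b -> ~~ (c < e < d')) ->
  c < t1 < d' -> c < t2 < d' -> Th j (line y b t1) -> Th j (line y b t2).
Proof.
move=> nE /andP[c1 d1] /andP[c2 d2] T1.
set I := [set t | Th j (line y b t)].
have It t : I t -> 0 <= t <= T.
  by move=> /Th_cylinder /closure_cylinder[_]; rewrite lineE.
have I1 : I t1 by [].
have between u1 u2 : I u1 -> I u2 -> u1 <= t2 <= u2 -> I t2.
  move=> Iu1 Iu2 /andP[l1 l2].
  have [u12|u12] := eqVneq u1 u2.
    by rewrite (_ : t2 = u1)//; apply/le_anti; rewrite l1 u12 l2.
  have lt12 : u1 < u2 by rewrite lt_neqAle u12 (le_trans l1).
  have u0 : 0 < u2 - u1 by rewrite subr_gt0.
  pose w := (u2 - t2) / (u2 - u1).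
  have -> : t2 = w * u1 + (1 - w) * u2 by rewrite /w; field; rewrite gt_eqF.
  rewrite /I /= line_convex; apply: Th_convex => //.
  rewrite divr_ge0 ?subr_ge0 ?(ltW lt12)//= ler_pdivrMr// mul1r lerD2l lerN2//.
have [t12|t12] := leP t1 t2.
  have hs : has_sup I by split; [exists t1|exists T => t /It/andP[]].
  have sE : sup I \in breakpoints y b.
    by rewrite mem_cat; apply/orP; left; apply: map_f; rewrite mem_enum.
  have s1 : t1 <= sup I by apply: ub_le_sup => //; case: hs.
  have := nE _ sE; rewrite negb_and -!leNgt leNgt (lt_le_trans c1 s1)/= => ds.
  have [u Iu ut] := sup_gt (proj1 hs) (lt_le_trans d2 ds).
  by apply: (between t1 u) => //; rewrite t12 ltW.
have hi : has_inf I by split; [exists t1|exists 0 => t /It/andP[]].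
have iE : inf I \in breakpoints y b.
  by rewrite mem_cat; apply/orP; right; apply: map_f; rewrite mem_enum.
have i1 : inf I <= t1 by apply: ge_inf => //; case: hi.
have := nE _ iE; rewrite negb_and -!leNgt orbC leNgt (le_lt_trans i1 d1)/= => ic.
have [u Iu ut] := inf_lt (proj1 hi) (le_lt_trans ic c2).
by apply: (between u t1) => //; rewrite (ltW t12) ltW.
Qed.

(** Either the piece of line touches an element and then stays in it, or it misses the closed
    cylinder and the extension is 0. *)
Lemma vext_line_poly r v y b c d' : Vh r Os T Th v ->
  (forall e, e \in breakpoints y b -> ~~ (c < e < d')) ->
  exists p : {poly R}, forall t, c < t < d' ->
    (v \_ (closure Om)) (line y b t) ^+ 2 = p.[t].
Proof.
move=> [_ pv _ _] nE.
have [[t [tcd [j Tj]]]|nT] := pselect (exists t, c < t < d' /\ exists j, Th j (line y b t)).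
  have [p pr pP] := pv j.
  have [q _ qE] := @poly_eval_line R d r p (y, 0) (b, 1) pr.
  exists (q ^+ 2) => t' t'cd.
  have Tj' := Th_line_itv nE tcd t'cd Tj.
  rewrite patchE mem_set; last exact: Th_cylinder Tj'.
  by rewrite pP// -/(line y b t') horner_exp -qE.
exists 0 => t tcd; rewrite patchE memNset ?expr0n ?horner0//.
case: tess => _ _ _ -> [j _ Tj]; apply: nT; exists t; split=> //; by exists j.
Qed.

Context (beta : 'rV[R]_d).

Lemma hstreamE f p j z : elementwise f p -> (Th j)° z ->
  hstream beta Th f z =
  \sum_(k < d.+1) xcoord (beta, 1) k * poly_eval (mderiv k (p j)) z.
Proof.
move=> fp Tz; rewrite /hstream /hadv.
rewrite (elementwise_hdt fp Tz) big_ord_recr /=.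
have lE i : widen_ord (leqnSn d) i = lift ord_max i.
  by apply/val_inj; rewrite /= /bump leqNgt ltn_ord.
rewrite {2}/xcoord unlift_none mul1r; congr (_ + _); apply: eq_bigr => i _.
by rewrite lE (elementwise_hdx i fp Tz) /xcoord liftK.
Qed.

(** Off the skeleton, a point is either interior to an element, where the chain rule along the
    space-time direction [(beta, 1)] applies, or outside the closed cylinder, where both sides
    vanish. *)
Lemma derive_vext_line r v y t : Vh r Os T Th v ->
  ~ (closure Om `\` elems) (line y beta t) ->
  'D_1 (fun t => (v \_ (closure Om)) (line y beta t) ^+ 2) t =
  ((fun z => 2 * (hstream beta Th v z * v z)) \_ Om) (line y beta t).
Proof.
move=> [_ pv _ _] nS.
have /choice[p pP] : forall j, exists q : mpoly d.+1 R, forall z, Th j z -> v z = poly_eval q z.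
  by move=> j; have [q _ qv] := pv j; exists q.
have vp : elementwise v p by move=> j z /interior_subset; exact: pP.
have cl := @continuous_line y beta t.
have [[j _ Tj]|nel] := pselect (elems (line y beta t)).
  have Oz : Om (line y beta t) by apply: elems_cylinder; exists j.
  have nO : \forall u \near t, (v \_ (closure Om)) (line y beta u) ^+ 2 = v (line y beta u) ^+ 2.
    have : \forall u \near t, Om (line y beta u).
      by apply: (cl Om); apply: open_nbhs_nbhs; split=> //; exact: open_cylinder.
    by apply: filterS => u /subset_closure cu; rewrite patchE mem_set.
  rewrite (near_eq_derive _ nO) patchE mem_set//.
  have := is_derive_elementwise (beta, 1) vp Tj; rewrite -(hstreamE vp Tj).
  move=> /is_derive_line dv.
  have [_ dv2] := is_deriveX 2 dv.
  by apply: etrans dv2 _; rewrite /= expr1 /GRing.scale/= -/(line y beta t); ring.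
have nc : ~ closure Om (line y beta t) by move=> h; apply: nS; split.
have nO : \forall u \near t, (v \_ (closure Om)) (line y beta u) ^+ 2 = cst 0 u.
  have : \forall u \near t, ~ closure Om (line y beta u).
    apply: (cl (~` closure Om)); apply: open_nbhs_nbhs; split=> //.
    by apply: closed_openC; exact: closed_closure.
  by apply: filterS => u nu; rewrite patchE memNset// expr0n.
rewrite (near_eq_derive _ nO) derive_cst patchE memNset//.
by move/subset_closure.
Qed.

Lemma Vh_elementwise r v : Vh r Os T Th v ->
  exists2 p : 'I_N -> mpoly d.+1 R, (forall j, (msize (p j) <= r.+1)%N) & elementwise v p.
Proof.
move=> [_ pv _ _].
have /choice[p pP] : forall j, exists q : mpoly d.+1 R, (msize q <= r.+1)%N /\
    forall z, Th j z -> v z = poly_eval q z.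
  by move=> j; have [q sq qv] := pv j; exists q.
exists p; first by move=> j; case: (pP j).
by move=> j z /interior_subset; case: (pP j) => _; apply.
Qed.

Lemma bmeas_hdx f p i : elementwise f p -> bmeas (hdx Th i f).
Proof.
move=> fp; apply: bmeas_elementwise (elementwise_hdx i fp) _ => z.
exact: hderive_skeleton.
Qed.

Lemma bmeas_hdt f p : elementwise f p -> bmeas (hdt Th f).
Proof.
move=> fp; apply: bmeas_elementwise (elementwise_hdt fp) _ => z.
exact: hderive_skeleton.
Qed.

Lemma bmeas_hadv f p : elementwise f p -> bmeas (hadv beta Th f).
Proof. by move=> fp; apply: bmeas_sum => i; apply: bmeasZ; exact: bmeas_hdx fp. Qed.

Lemma bmeas_hstream f p : elementwise f p -> bmeas (hstream beta Th f).
Proof.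
by move=> fp; apply: bmeasD; [exact: bmeas_hadv fp|exact: bmeas_hdt fp].
Qed.

Lemma bmeas_hlaplace f p : elementwise f p -> bmeas (hlaplace Th f).
Proof.
move=> fp; apply: bmeas_sum => i.
exact: bmeas_hdx (elementwise_hdx i fp).
Qed.

Lemma spt_shear (t : R) (s : d.-tuple (measurableTypeR R)) :
  spt (shear [tuple beta 0 i | i < d] (t, s)) = line (vec s) beta t.
Proof.
rewrite /shear spt_cons lineE; congr pair; apply/rowP => i.
by rewrite !mxE /= !tnth_mktuple mul1r addrC.
Qed.

Lemma integral_line r v (s : d.-tuple (measurableTypeR R)) : Vh r Os T Th v ->
  let g := fun z => 2 * (hstream beta Th v z * v z) in
  {ae @lebesgue_measure R, forall t, ~ (closure Om `\` elems) (line (vec s) beta t)} ->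
  (\int[@lebesgue_measure R]_t ((g \_ Om) (line (vec s) beta t))%:E =
   ((v \_ (closure Om)) (line (vec s) beta T) ^+ 2)%:E)%E.
Proof.
move=> Vv g nS.
have [p _ vp] := Vh_elementwise Vv.
have bg : bmeas g.
  by apply: bmeasZ; apply: bmeasM; [exact: bmeas_hstream vp|exact: bmeas_Vh Vv].
have [mg [C gC]] := bg.
have ig : (@lebesgue_measure R).-integrable `[0, T] (EFin \o (fun t => (g \_ Om) (line (vec s) beta t))).
  apply: measurable_bounded_integrable => //.
  - by rewrite /= lebesgue_measure_itv/= lte_fin T_gt0 -EFinB ltry.
  - apply: measurable_funTS.
    rewrite (_ : (fun t => _) = (fun s => (g \_ Om) (spt s)) \o
      (shear [tuple beta 0 i | i < d] \o (fun t : measurableTypeR R => (t, s)))).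
      apply: measurableT_comp => //.
      by apply: (measurableT_comp (@measurable_shear R d _)); exact: pair2_measurable.
    by apply/funext => t /=; rewrite spt_shear.
  - by exists C; split; [exact: num_real|move=> x xC t _ /=; rewrite (le_trans (gC _))// ltW].
(* The starting point is in the domain (initial condition), on its boundary (lateral condition), or
   outside its closure (extension by 0). *)
have v0 : (v \_ (closure Om)) (line (vec s) beta 0) = 0.
  rewrite patchE; case: ifPn => //; rewrite inE => c0.
  have [Oy|nOy] := pselect (Os (line (vec s) beta 0).1); last exact: Vh_boundary Vv c0 nOy.
  by case: Vv => _ _ _ /(_ _ Oy); rewrite lineE.
have -> : (v \_ (closure Om)) (line (vec s) beta T) ^+ 2 =
    (v \_ (closure Om)) (line (vec s) beta T) ^+ 2 -
    (v \_ (closure Om)) (line (vec s) beta 0) ^+ 2 by rewrite v0 expr0n subr0.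
rewrite -(@FTC_ae_piecewise_poly R (breakpoints (vec s) beta)
  (fun t => (v \_ (closure Om)) (line (vec s) beta t) ^+ 2)
  (fun t => (g \_ Om) (line (vec s) beta t)) 0 T).
- rewrite /Rintegral fineK; last exact: integrable_fin_num.
  rewrite [RHS]integral_mkcond; apply: eq_integral => t _.
  rewrite [RHS]patchE; case: ifPn => //; rewrite notin_setE /= in_itv/= => nt.
  rewrite lineE cyl_notin// => /andP[h1 h2]; apply: nt.
  by rewrite !ltW.
- exact: ltW.
- have cF := @continuous_vext_line _ _ (vec s) beta Vv.
  move=> t; apply: (@continuous_comp (subspace `[0, T]%classic) R R _ (fun x => x ^+ 2) t (cF t)).
  exact: exprn_continuous.
- by move=> c d' _ _ _; exact: vext_line_poly Vv.
- exact: ig.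
- apply: (@filterS _ _ (ae_filter_ringOfSetsType _) _ _ _ nS) => t nSt _.
  exact: derive_vext_line Vv nSt.
Qed.

Lemma vext_final r v : Vh r Os T Th v -> forall x,
  (v \_ (closure Om)) (x, T) = if x \in Os then v (x, T) else 0.
Proof.
move=> Vv x; rewrite patchE; case: ifPn => [|nc]; case: ifPn => //; rewrite ?inE ?notin_setE.
  by move=> nO cx; exact: Vh_boundary Vv cx nO.
move=> Ox; move: nc; rewrite notin_setE => -[].
by apply/closure_cylinder; split=> /=; [exact: subset_closure|rewrite lexx ltW].
Qed.

Lemma measurable_vext_final r v : Vh r Os T Th v ->
  measurable_fun setT (fun s : d.-tuple (measurableTypeR R) => (v \_ (closure Om)) (vec s, T)).
Proof.
move=> Vv; have [cv _ _ _] := Vv.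
rewrite (_ : (fun s => _) = (fun s => v (vec s, T)) \_ (@vec R d @^-1` Os)); last first.
  by apply/funext => s; rewrite (vext_final Vv) patchE; congr (if _ then _ else _).
apply/(measurable_restrictT _ _).1; first exact: space_measurable.
apply: (measurability _ (RGenOInfty.measurableE R)) => _ [_ [a ->]] <-.
rewrite preimage_itvoy.
rewrite [X in measurable X](_ : _ = @vec R d @^-1` [set x | Os x /\ a < v (x, T)]); last by [].
apply: open_measurable_vec; rewrite openE => x [Ox ax].
have cl y : Os y -> closure Om (y, T).
  by move=> Oy; apply/closure_cylinder; split=> /=; [exact: subset_closure|rewrite lexx ltW].
have e0 : 0 < v (x, T) - a by rewrite subr_gt0.
have n1 := within_continuous_near cv (cl _ Ox) e0.
have n2 : \forall w \near x, Os w by apply: open_nbhs_nbhs.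
have n3 : \forall w \near x, closure Om (w, T) -> `|v (x, T) - v (w, T)| < v (x, T) - a.
  have /nbhs_ballP[e /= e1 He] := n1.
  apply: filterS (nbhsx_ballx x e e1) => w bw; apply: He.
  by split=> //=; exact: ballxx.
near=> w; have Ow : Os w by near: w.
split=> //.
have : `|v (x, T) - v (w, T)| < v (x, T) - a by move: (cl _ Ow); near: w.
by rewrite ltr_norml => /andP[_]; rewrite ltrD2l ltrN2.
Unshelve. all: by end_near.
Qed.

Lemma energy_identity r v : Vh r Os T Th v ->
  cyl_int (fun z => 2 * (hstream beta Th v z * v z)) =
  ip Os (at_time v T) (at_time v T).
Proof.
move=> Vv; set g := fun z => _.
have [p _ vp] := Vh_elementwise Vv.
have bg : bmeas g.
  by apply: bmeasZ; apply: bmeasM; [exact: bmeas_hstream vp|exact: bmeas_Vh Vv].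
have ig := bmeas_integrable bg.
pose b := [tuple beta 0 i | i < d].
have mS : measurable (@spt R d @^-1` (closure Om `\` elems)).
  apply: closed_measurable_spt; rewrite setDE; apply: closedI.
    exact: closed_closure.
  by apply: open_closedC; exact: open_elems.
have ae := null_shear b mS skeleton_null.
pose Q (s : d.-tuple (measurableTypeR R)) : \bar R := ((v \_ (closure Om)) (vec s, T) ^+ 2)%:E.
have mQ : measurable_fun setT Q.
  by apply/measurable_EFinP; apply: measurable_funX; exact: measurable_vext_final Vv.
pose b' := [tuple T * tnth b i | i < d].
rewrite /cyl_int /Rintegral (integral_cons_pair ig) -(integral_shear b ig).
rewrite /ip /Rintegral; congr fine.
(* A characteristic starting from s ends at s + T beta, so the end values are those of [Q]
   translated by b'; the translation is then undone. *)
transitivity (\int[leb R d]_s Q (affine_tuple b' 1 s))%E.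
  apply: ae_eq_integral => //.
  - exact: (measurable_fubini_G (integrable_shear b ig)).
  - by apply: measurableT_comp => //; exact: measurable_affine_tuple.
  apply: (@filterS _ _ (ae_filter_ringOfSetsType _) _ _ _ ae) => s nS _.
  under eq_integral do rewrite spt_shear.
  rewrite (integral_line Vv); last first.
    apply: (@filterS _ _ (ae_filter_ringOfSetsType _) _ _ _ nS) => t.
    by rewrite /preimage /= spt_shear.
  by rewrite /Q -spt_shear /shear spt_cons.
rewrite integral_leb_translate// [RHS]integral_mkcond; apply: eq_integral => s _.
rewrite /Q (vext_final Vv) patchE.
rewrite -[vec s \in Os]/(s \in @vec R d @^-1` Os).
by case: ifP => // _; rewrite expr0n.
Qed.

(** * The inverse inequality on the mesh *)

Lemma cyl_int_sqrE f p : elementwise f p -> (forall z, ~ elems z -> f z = 0) ->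
  ((cyl_int (fun z => f z ^+ 2))%:E =
   \sum_(j < N) \int[leb R d.+1]_(s in @spt R d @^-1` (Th j)°) (poly_eval (p j) (spt s) ^+ 2)%:E)%E.
Proof.
move=> fp f0; have bf := bmeas_elementwise fp f0.
rewrite /cyl_int /Rintegral fineK; last first.
  by apply: integrable_fin_num => //; apply: bmeas_integrable; exact: bmeasM.
under [RHS]eq_bigr do rewrite integral_mkcond.
rewrite -ge0_integral_sum//; last 2 first.
- move=> j; apply/(measurable_restrictT _ _).1.
    by apply: open_measurable_spt; exact: open_interior.
  apply/measurable_EFinP; apply: measurable_funTS; apply: measurable_funX.
  exact: measurable_poly_eval.
- by move=> j s _; rewrite patchE; case: ifP => // _; rewrite lee_fin sqr_ge0.
apply: eq_integral => s _; rewrite patchE.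
have [[j _ Tj]|nz] := pselect (elems (spt s)).
  rewrite mem_set; last by apply: elems_cylinder; exists j.
  rewrite (bigD1 j)//= patchE mem_set// (fp j)// big1 ?adde0// => i ij.
  rewrite patchE memNset// => Ti; move/eqP: ij; apply; exact: elem_inj Ti Tj.
rewrite f0// expr0n if_same big1// => j _; rewrite patchE memNset// => Tj; apply: nz; exists j => //.
Qed.

(** Shape regularity gives a Euclidean ball of radius at least [sigma * kappa * h]; dividing by
    [d.+1], the factor of [enorm_le], fits a cube into it. The outer bound is [diam (Th j) <= h]. *)
Lemma elem_box (sigma kappa h : R) j : 0 < h -> 0 < sigma -> 0 < kappa ->
  shape_regular sigma Th -> quasiuniform kappa h Th ->
  exists c, (forall s, box (coords c) (sigma * kappa * h / d.+1%:R) s -> (Th j)° (spt s)) /\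
    forall z, Th j z -> forall i, `|xcoord z i - xcoord c i| <= h.
Proof.
move=> h0 s0 k0 sr qu; have [c cT] := sr j.
have /andP[kd dh] := qu j.
have D0 : 0 < diam (Th j) by apply: lt_le_trans kd; rewrite mulr_gt0.
have a0 : 0 < sigma * kappa * h / d.+1%:R by rewrite divr_gt0// !mulr_gt0.
have sub : ball c (sigma * kappa * h / d.+1%:R) `<=` Th j.
  move=> z /(ball_xcoord _ _ a0) bz; apply: cT.
  apply: (@le_trans _ _ (sigma * (kappa * h))); last by rewrite ler_pM2l.
  apply: (@le_trans _ _ (d.+1%:R * (sigma * kappa * h / d.+1%:R))).
    by apply: enorm_le => [|i]; [exact: ltW|rewrite xcoordB ltW].
  by rewrite mulrC divfK ?pnatr_eq0// mulrA.
exists c; split.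
  move=> s /(box_ball _ _ a0) bs.
  apply: (filterS sub); apply: open_nbhs_nbhs; split=> //.
  exact: ball_open.
move=> z Tz i; rewrite -xcoordB; apply: le_trans (xcoord_le_enorm _ _) _.
apply: le_trans dh; apply: le_diam => //.
by apply: sub; exact: ballxx.
Qed.

(** The inverse estimate is applied on each element to the polynomial of the first derivative, then
    summed. Its conclusion enters as a hypothesis so that [C] is chosen before the mesh. *)
Lemma hlaplace_le (sigma kappa h L C : R) r v :
  0 < h -> 0 < sigma -> 0 < kappa ->
  shape_regular sigma Th -> quasiuniform kappa h Th ->
  h <= L * (sigma * kappa * h / d.+1%:R) -> 0 < C ->
  (forall (q : mpoly d.+1 R) (K : set ('rV[R]_d * R)) c (a : R) (k : 'I_d.+1),
    (msize q <= r.+1)%N -> 0 < a -> open K ->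
    (forall s, box (coords c) a s -> K (spt s)) ->
    (forall z, K z -> forall i, `|xcoord z i - xcoord c i| <= L * a) ->
  ((a ^+ 2)%:E * \int[leb R d.+1]_(s in @spt R d @^-1` K) (poly_eval (mderiv k q) (spt s) ^+ 2)%:E
   <= C%:E * \int[leb R d.+1]_(s in @spt R d @^-1` K) (poly_eval q (spt s) ^+ 2)%:E)%E) ->
  Vh r Os T Th v -> forall i,
  (sigma * kappa * h / d.+1%:R) ^+ 2 * cyl_int (fun z => hdx Th i (hdx Th i v) z ^+ 2) <=
    C * cyl_int (fun z => hdx Th i v z ^+ 2).
Proof.
move=> h0 s0 k0 sr qu hL C0 HC Vv i.
have a0 : 0 < sigma * kappa * h / d.+1%:R by rewrite divr_gt0// !mulr_gt0.
set a := sigma * kappa * h / d.+1%:R in a0 hL *.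
have [p sp vp] := Vh_elementwise Vv.
have vp1 := elementwise_hdx i vp; have vp2 := elementwise_hdx i vp1.
have e2 := cyl_int_sqrE vp2 (fun z nz => hderive_skeleton _ _ nz).
have e1 := cyl_int_sqrE vp1 (fun z nz => hderive_skeleton _ _ nz).
move: (cyl_int _) (cyl_int _) e2 e1 => X2 X1 e2 e1.
rewrite -lee_fin !EFinM e2 e1.
rewrite !ge0_sume_distrr//; try by move=> j _; apply: integral_ge0 => s _; rewrite lee_fin sqr_ge0.
apply: lee_sum => j _.
have [c [bT TL]] := elem_box j h0 s0 k0 sr qu.
apply: (HC _ _ c) => //.
- exact: msize_mderiv.
- exact: open_interior.
by move=> z /interior_subset Tz k; apply: le_trans (TL _ Tz k) _.
Qed.

(** * Evaluation of the forms and coercivity *)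

Lemma time_int_slice_eq F f : bmeas f ->
  (forall t, 0 < t < T -> F t = slice_int f t) -> time_int T F = cyl_int f.
Proof.
move=> bf FE; rewrite -time_int_slice//; apply: eq_Rintegral => t.
by rewrite inE /= in_itv/= => /FE.
Qed.

Lemma cyl_int_sum (n : nat) (f : 'I_n -> 'rV[R]_d * R -> R) :
  (forall i, bmeas (f i)) ->
  cyl_int (fun z => \sum_(i < n) f i z) = \sum_(i < n) cyl_int (f i).
Proof.
elim: n f => [|n IH] f bf.
  rewrite big_ord0 (_ : (fun z => _) = fun z => 0 * 0).
    by rewrite cyl_intZ ?mul0r//; exact: bmeas_cst.
  by apply/funext => z; rewrite big_ord0 mul0r.
rewrite big_ord_recl -IH// -cyl_intD//; last exact: bmeas_sum.
by congr cyl_int; apply/funext => z; rewrite big_ord_recl.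
Qed.

Section vh.
Context (r : nat) (v : 'rV[R]_d * R -> R) (Vv : Vh r Os T Th v).
Context (alpha gamma : R).

Lemma bmeas_v : bmeas v. Proof. exact: bmeas_Vh Vv. Qed.

Lemma bmeas_hdx_v i : bmeas (hdx Th i v).
Proof. by have [p _ vp] := Vh_elementwise Vv; exact: bmeas_hdx vp. Qed.

Lemma bmeas_hdt_v : bmeas (hdt Th v).
Proof. by have [p _ vp] := Vh_elementwise Vv; exact: bmeas_hdt vp. Qed.

Lemma bmeas_hadv_v : bmeas (hadv beta Th v).
Proof. by have [p _ vp] := Vh_elementwise Vv; exact: bmeas_hadv vp. Qed.

Lemma bmeas_hstream_v : bmeas (hstream beta Th v).
Proof. by have [p _ vp] := Vh_elementwise Vv; exact: bmeas_hstream vp. Qed.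

Lemma bmeas_hdxdx_v i : bmeas (hdx Th i (hdx Th i v)).
Proof.
by have [p _ vp] := Vh_elementwise Vv; exact: bmeas_hdx (elementwise_hdx i vp).
Qed.

Lemma bmeas_hlaplace_v : bmeas (hlaplace Th v).
Proof. by have [p _ vp] := Vh_elementwise Vv; exact: bmeas_hlaplace vp. Qed.

Let E := ip Os (at_time v T) (at_time v T).
Let G := \sum_(i < d) cyl_int (fun z => hdx Th i v z * hdx Th i v z).
Let S := cyl_int (fun z => hstream beta Th v z * hstream beta Th v z).
Let M := cyl_int (fun z => v z * v z).

Lemma cyl_int_stream_v : cyl_int (fun z => hstream beta Th v z * v z) = E / 2.
Proof.
have := energy_identity Vv; rewrite cyl_intZ; last first.
  exact: bmeasM bmeas_hstream_v bmeas_v.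
by rewrite -/E => <-; rewrite mulrC mulKf.
Qed.

(** The time derivative and the advection term, tested with [v], add up to the streamline term,
    which the energy identity evaluates; the other terms are squares. *)
Lemma B_vE : B alpha gamma beta Os T Th v v = E / 2 + alpha * G + gamma * M.
Proof.
have b1 := bmeasM bmeas_hdt_v bmeas_v.
have b2 i := bmeasM (bmeas_hdx_v i) (bmeas_hdx_v i).
have b3 := bmeasM bmeas_hadv_v bmeas_v.
have b4 := bmeasM bmeas_v bmeas_v.
have b2s := bmeas_sum b2.
have b2a := bmeasZ alpha b2s; have b4g := bmeasZ gamma b4.
have b12 := bmeasD b1 b2a; have b123 := bmeasD b12 b3.
rewrite /B (time_int_slice_eq (bmeasD b123 b4g)); last first.
  move=> t tT; rewrite slice_intD// slice_intD// slice_intD// slice_intZ// slice_intZ//.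
  by rewrite slice_int_sum.
rewrite cyl_intD// cyl_intD// cyl_intD// cyl_intZ// cyl_intZ// cyl_int_sum//.
rewrite -cyl_int_stream_v.
rewrite (_ : (fun z => hstream beta Th v z * v z) =
  (fun z => hadv beta Th v z * v z + hdt Th v z * v z)); last first.
  by apply/funext => z; rewrite /hstream mulrDl.
by rewrite cyl_intD// -/G -/M; ring.
Qed.

Lemma energy_normE p h : 0 <= alpha -> 0 <= gamma -> 0 <= h ->
  energy_norm alpha gamma beta Os T Th p h v ^+ 2 =
  E + (alpha * G + h ^+ p * nu beta * S + gamma * M).
Proof.
move=> a0 g0 h0.
have b2 i := bmeasM (bmeas_hdx_v i) (bmeas_hdx_v i).
have b3 := bmeasM bmeas_hstream_v bmeas_hstream_v.
have b4 := bmeasM bmeas_v bmeas_v.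
have b2s := bmeas_sum b2; have b2a := bmeasZ alpha b2s; have b4g := bmeasZ gamma b4.
have b3h := bmeasZ (h ^+ p * nu beta) b3; have b23 := bmeasD b2a b3h.
rewrite /energy_norm (time_int_slice_eq (bmeasD b23 b4g)); last first.
  move=> t tT; rewrite slice_intD// slice_intD// slice_intZ// slice_intZ// slice_intZ//.
  by rewrite slice_int_sum.
rewrite cyl_intD// cyl_intD// cyl_intZ// cyl_intZ// cyl_intZ// cyl_int_sum// sqr_sqrtr//.
rewrite addr_ge0//; first by apply: Rintegral_ge0 => s _; rewrite /at_time -expr2 sqr_ge0.
have sq f : 0 <= cyl_int (fun z => f z * f z).
  by apply: cyl_int_ge0 => z _; rewrite -expr2 sqr_ge0.
have nu0 : 0 <= nu beta by rewrite invr_ge0 sqrtr_ge0.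
by rewrite !addr_ge0// mulr_ge0// ?sumr_ge0// mulr_ge0// exprn_ge0.
Qed.

(** Sum of x_i x_j <= (x_i^2 + x_j^2) / 2 over all pairs. It puts the factor [d] between the
    Laplacian and the pure second derivatives. *)
Lemma sqr_sum_le (n : nat) (x : 'I_n -> R) :
  (\sum_(i < n) x i) ^+ 2 <= n%:R * \sum_(i < n) x i ^+ 2.
Proof.
rewrite expr2 big_distrlr /=.
apply: (@le_trans _ _ (\sum_(i < n) \sum_(j < n) (x i ^+ 2 / 2 + x j ^+ 2 / 2))).
  by apply: ler_sum => i _; apply: ler_sum => j _; have := sqr_ge0 (x i - x j); nra.
set Q := \sum_(i < n) x i ^+ 2.
rewrite (eq_bigr (fun i => n%:R * (x i ^+ 2 / 2) + Q / 2)) => [|i _]; last first.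
  by rewrite big_split/= sumr_const card_ord -(mulr_natl (_ / 2)) -mulr_suml.
rewrite big_split/= -mulr_sumr -mulr_suml sumr_const card_ord -/Q -(mulr_natl (Q / 2)).
by rewrite -mulrDr -splitr.
Qed.

(** With s the streamline derivative, l the Laplacian and w the value, (s - alpha l + gamma w) s
    exceeds s^2 / 2 - alpha^2 l^2 / 2 + gamma w s by (s - alpha l)^2 / 2. After integration the term
    in gamma w s is a nonnegative multiple of [E] and is dropped. *)
Lemma Bh_ge (h theta K : R) : 0 <= gamma -> 0 <= theta ->
  h ^+ 2 * cyl_int (fun z => hlaplace Th v z * hlaplace Th v z) <= K * G ->
  E / 2 + alpha * G + gamma * M
    + theta * nu beta * (h ^+ 2 * S / 2 - alpha ^+ 2 * (K * G) / 2)
  <= Bh alpha gamma beta Os T Th 2 h theta v v.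
Proof.
move=> g0 t0 HK.
have nu0 : 0 <= nu beta by rewrite invr_ge0 sqrtr_ge0.
have c0 : 0 <= theta * h ^+ 2 * nu beta by rewrite mulr_ge0// mulr_ge0// sqr_ge0.
set c := theta * h ^+ 2 * nu beta in c0.
have bs := bmeas_hstream_v; have bl := bmeas_hlaplace_v; have bv := bmeas_v.
have bL : bmeas (hL alpha gamma beta Th v).
  have := bmeasD (bmeasD (bmeasD bmeas_hdt_v (bmeasZ (- alpha) bl)) bmeas_hadv_v) (bmeasZ gamma bv).
  by congr bmeas; apply/funext => z; rewrite /hL mulNr.
have bf := bmeasM bL (bmeasZ c bs).
rewrite /Bh B_vE lerD2l (time_int_slice_eq bf)//.
have b1 := bmeasM bs bs; have b2 := bmeasM bl bl; have b3 := bmeasM bs bv.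
have b1z := bmeasZ (c / 2) b1; have b2z := bmeasZ (- (c * alpha ^+ 2 / 2)) b2.
have b3z := bmeasZ (c * gamma) b3; have b12 := bmeasD b1z b2z.
apply: le_trans (le_cyl_int (bmeasD b12 b3z) bf _); last first.
  move=> z _; rewrite /hL.
  have sE : hstream beta Th v z = hadv beta Th v z + hdt Th v z by [].
  rewrite (_ : hdt Th v z - _ + _ + _ =
    hstream beta Th v z - alpha * hlaplace Th v z + gamma * v z); last by rewrite sE; ring.
  move: (hstream beta Th v z) (hlaplace Th v z) (v z) => s l w.
  have := mulr_ge0 c0 (sqr_ge0 (s - alpha * l)); nra.
rewrite cyl_intD// cyl_intD// cyl_intZ// cyl_intZ// cyl_intZ// cyl_int_stream_v -/S.
have E0 : 0 <= E by apply: Rintegral_ge0 => s _; rewrite /at_time -expr2 sqr_ge0.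
have h1 : 0 <= c * gamma * (E / 2) by rewrite mulr_ge0 ?divr_ge0// mulr_ge0.
have h2 := ler_wpM2l (mulr_ge0 (mulr_ge0 t0 nu0) (sqr_ge0 alpha)) HK.
rewrite /c in h1 *; move: HK h2; set La := cyl_int _ => HK h2.
nra.
Qed.

Lemma hlaplace_sqr_le (a C : R) :
  (forall i, a ^+ 2 * cyl_int (fun z => hdx Th i (hdx Th i v) z ^+ 2) <=
    C * cyl_int (fun z => hdx Th i v z ^+ 2)) ->
  a ^+ 2 * cyl_int (fun z => hlaplace Th v z * hlaplace Th v z) <= d%:R * C * G.
Proof.
move=> HC.
have b2 i := bmeasM (bmeas_hdxdx_v i) (bmeas_hdxdx_v i).
have b2s := bmeas_sum b2.
have bl := bmeasM bmeas_hlaplace_v bmeas_hlaplace_v.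
have : cyl_int (fun z => hlaplace Th v z * hlaplace Th v z) <=
    d%:R * \sum_(i < d) cyl_int (fun z => hdx Th i (hdx Th i v) z ^+ 2).
  rewrite -cyl_int_sum; last by move=> i; exact: b2.
  rewrite -cyl_intZ; last exact: b2s.
  apply: le_cyl_int => //; first exact: bmeasZ.
  by move=> z _; rewrite -expr2; exact: sqr_sum_le.
have : a ^+ 2 * \sum_(i < d) cyl_int (fun z => hdx Th i (hdx Th i v) z ^+ 2) <= C * G.
  have linear (X Y : 'I_d -> R) : (forall i, a ^+ 2 * X i <= C * Y i) ->
      a ^+ 2 * (\sum_i X i) <= C * \sum_i Y i.
    by move=> XY; rewrite !mulr_sumr; apply: ler_sum => i _; exact: XY.
  exact: linear HC.
move: (\sum_(i < d) _) (cyl_int _) G => W X G'.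
move=> /(ler_wpM2l (ler0n R d)) h1 /(ler_wpM2l (sqr_ge0 a)) h2.
by apply: (le_trans h2); rewrite mulrCA -[leRHS]mulrA.
Qed.

End vh.
End mesh.

(** Keeps the threshold for [theta] free of [beta]. *)
Lemma nu_le1 (R : realType) (d : nat) (beta : 'rV[R]_d) : nu beta <= 1.
Proof.
have b0 : 1 <= \sum_(i < d) beta 0 i ^+ 2 + 1.
  by rewrite lerDr; apply: sumr_ge0 => i _; exact: sqr_ge0.
rewrite /nu invf_le1 ?sqrtr_gt0 ?(lt_le_trans ltr01)//.
by rewrite -[leLHS]sqrtr1 ler_wsqrtr.
Qed.

Theorem lemma3 (R : realType) (d : nat) (Os : set 'rV[R]_d)
    (T alpha gamma : R) (beta : 'rV[R]_d) (r : nat) (sigma kappa : R)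
    (d_gt0 : (0 < d)%N) (Os_dom : spatial_domain Os) (T_gt0 : 0 < T)
    (alpha_ge0 : 0 <= alpha) (alpha_neq0 : alpha != 0) (gamma_ge0 : 0 <= gamma)
    (r_gt1 : (1 < r)%N) (sigma_gt0 : 0 < sigma) (kappa_gt0 : 0 < kappa) :
  exists2 theta0 : R, 0 < theta0 &
  forall theta : R, 0 < theta < theta0 ->
  exists2 C : R, 0 < C &
  forall (h : R) (N : nat) (Th : 'I_N -> set ('rV[R]_d * R)%type),
    0 < h ->
    tessellation Os T Th -> shape_regular sigma Th -> quasiuniform kappa h Th ->
  forall v : 'rV[R]_d * R -> R, Vh r Os T Th v ->
    Bh alpha gamma beta Os T Th 2 h theta v v
    >= C * energy_norm alpha gamma beta Os T Th 2 h v ^+ 2.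
Proof.
have [Os_open _ _ Os_bounded] := Os_dom.
(* This is h / a, with [a] the half side of the cube inside each element. The estimate is taken with
   [1 + rho] because it asks for a ratio of at least 1. *)
pose rho := d.+1%:R / (sigma * kappa).
have rho0 : 0 < rho by rewrite divr_gt0// mulr_gt0.
have rho1 : 1 <= 1 + rho by rewrite lerDl ltW.
have [C C0 HC] := @inverse_estimate R d r (1 + rho) rho1.
(* From h^2 = rho^2 a^2, the factor [d] of the Laplacian, and the constant of the inverse
   estimate. *)
pose K := rho ^+ 2 * (d%:R * C).
have K0 : 0 <= K by rewrite mulr_ge0 ?sqr_ge0// mulr_ge0// ltW.
have D0 : 0 < alpha * K + 1 by rewrite ltr_wpDl// mulr_ge0.
(* The gradient term must pay for [theta * alpha * K / 2] from Young's inequality and [theta / 2]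
   from the norm; the condition [theta * (alpha * K + 1) < 1] leaves half of it to spare. *)
exists (alpha * K + 1)^-1; first by rewrite invr_gt0.
move=> theta /andP[t0 tT]; exists (theta / 2); first by rewrite divr_gt0.
have tK : theta * (alpha * K) + theta < 1.
  by move: tT; rewrite -[X in _ < X]div1r ltr_pdivlMr// mulrDr mulr1.
move=> h N Th h0 tess sr qu v Vv.
pose a := sigma * kappa * h / d.+1%:R.
have ha : h = rho * a.
  rewrite /rho /a; field.
  by rewrite nat1r pnatr_eq0 /= !gt_eqF.
have a0 : 0 < a by rewrite divr_gt0// !mulr_gt0.
have hL : h <= (1 + rho) * a by rewrite mulrDl -ha mul1r lerDr ltW.
have HK := hlaplace_sqr_le Os_open Os_bounded T_gt0 tess Vv
  (hlaplace_le Os_open Os_bounded T_gt0 tess h0 sigma_gt0 kappa_gt0 sr qu hL C0 HC Vv).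
have := @Bh_ge R d Os T Os_open Os_bounded T_gt0 N Th tess beta r v Vv alpha gamma h theta K gamma_ge0 (ltW t0).
rewrite (energy_normE Os_open Os_bounded T_gt0 tess beta Vv 2 alpha_ge0 gamma_ge0 (ltW h0)).
set E := ip Os _ _; set G := \sum_(i < d) _; set S := cyl_int Os T (fun z => hstream _ _ _ _ * _).
set M := cyl_int Os T (fun z => v z * v z) => H.
have sq f : 0 <= cyl_int Os T (fun z => f z * f z).
  by apply: cyl_int_ge0 => z _; rewrite -expr2 sqr_ge0.
have M0 : 0 <= M by exact: sq.
have G0 : 0 <= G by apply: sumr_ge0 => i _; exact: sq.
have E0 : 0 <= E by apply: Rintegral_ge0 => s _; rewrite /at_time -expr2 sqr_ge0.
have {}H := H _; apply: le_trans (H _); last first.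
  have -> : K * G = rho ^+ 2 * (d%:R * C * G) by rewrite /K -mulrA.
  rewrite ha exprMn -[leLHS]mulrA; apply: ler_wpM2l; first exact: sqr_ge0.
  exact: HK.
have K1 : 0 <= theta * (alpha * K) by rewrite mulr_ge0 ?(ltW t0)// mulr_ge0.
have t1 : theta <= 1 by lra.
have aG : 0 <= alpha * G by rewrite mulr_ge0.
have gM : 0 <= gamma * M by rewrite mulr_ge0.
have h1 : theta * E <= E by rewrite ler_piMl.
have h2 : theta * (gamma * M) <= gamma * M by rewrite ler_piMl.
have h3 : (theta * (alpha * K) + theta) * (alpha * G) <= alpha * G.
  by rewrite ler_piMl// ltW.
have h4 : nu beta * (theta * (alpha * K) * (alpha * G)) <= theta * (alpha * K) * (alpha * G).
  by rewrite ler_piMl ?nu_le1// mulr_ge0.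
(* The streamline terms of both sides are equal, [theta / 2] times the same quantity; the listed
   inequalities settle the other terms, linearly in the monomials. *)
move: h1 h2 h3 h4 (ltW t0) E0 aG gM; clear.
move: (ip _ _ _) (cyl_int _ _ _) (cyl_int _ _ _) (nu _) @E @G @S @M => e m s n /=.
move: (\sum_(i < d) _) => g *; lra.
Qed.
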